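(* Let $L>0$, $a,b,c>0$, and let $p\in L^1[0,L]$ be nonnegative. Assume there is a constant $\lambda>0$ such that $$p(x)\le\Big[\lambda\frac{\pi^4}{L^4}+a\lambda\frac{\pi^2}{L^2}+2b\lambda^2\frac{\pi}{L}\Big]\sin\Big(\frac{\pi}{L}x\Big)+2\lambda c\frac{L}{\pi}\quad\text{for a.e. }x\in(0,L),$$ and $$c+b\lambda\frac{\pi^2}{L^2}\le\frac{4\big(a+2b\lambda\frac{L}{\pi}\big)}{L^3}\,\sigma\Big(\sqrt{a+2b\lambda\tfrac{L}{\pi}}\;L\Big).$$ Then $\alpha\equiv0$ is a lower solution and $\beta(x)=\lambda\sin(\frac{\pi}{L}x)$ is an upper solution of (P). Moreover, with $M=a+2b\lambda\frac{L}{\pi}$ and $N=c+b\lambda\frac{\pi^2}{L^2}$, the iterative sequences $(\alpha_n)$, $(\beta_n)$ generated by the iteration below from $y_0\equiv0$ and $y_0=\lambda\sin(\frac{\pi}{L}x)$ respectively converge uniformly to the minimal solution $\underline y$ and the maximal solution $\overline y$ of (P) in $\{u\in C^2[0,L]:0\le u\le\beta,\ 0\ge u''\ge\beta''\}$.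
   Context: (P) is the problem $w''''(x)-(a+b\int_0^L w(t)dt)w''(x)+c\int_0^L w(t)dt=p(x)$ a.e. in $(0,L)$, $w(0)=w(L)=w''(0)=w''(L)=0$, with solutions in $W^{4,1}[0,L]$. $\sigma(t):=\dfrac{3t^3}{6t\cosh t+6t-12\sinh t-t^3}$ for $t>0$. A lower solution of (P) is $\alpha\in W^{4,1}[0,L]$ with $\alpha''''-(a+b\int_0^L\alpha)\alpha''+c\int_0^L\alpha\le p$ a.e. and $\alpha(0)=\alpha(L)=\alpha''(0)=\alpha''(L)=0$; an upper solution has the reversed inequality. The iteration: $y_n\in W^{4,1}[0,L]$ is the unique solution of $$y_n''''-My_n''+N\int_0^L y_n\,dt=p(x)+b\,y_{n-1}''\int_0^L y_{n-1}\,dt-2b\lambda\frac{L}{\pi}y_{n-1}''+b\lambda\frac{\pi^2}{L^2}\int_0^L y_{n-1}\,dt,$$ $y_n(0)=y_n(L)=y_n''(0)=y_n''(L)=0$, $n\ge1$, with $M=a+2b\lambda L/\pi$, $N=c+b\lambda\pi^2/L^2$. *)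

(* Defs.v *)
From HB Require Import structures.
From mathcomp Require Import all_boot all_order all_algebra.
From mathcomp Require Import all_classical all_reals all_analysis.
Set Implicit Arguments. Unset Strict Implicit. Unset Printing Implicit Defensive.
Import Order.TTheory GRing.Theory Num.Theory.
Import numFieldNormedType.Exports.
Local Open Scope classical_set_scope.
Local Open Scope ring_scope.

Section Defs.
Variable R : realType.
Local Notation mu := (@lebesgue_measure R).

Definition coshR (t : R) : R := (expR t + expR (- t)) / 2.
Definition sinhR (t : R) : R := (expR t - expR (- t)) / 2.

Definition sigma (t : R) : R :=
  3 * t ^+ 3 / (6 * t * coshR t + 6 * t - 12 * sinhR t - t ^+ 3).

Definition int0 (f : R -> R) (x : R) : R := \int[mu]_(t in `[0, x]) f t.

(* A "W^{4,1}[0,L] datum": d 0 = w, d k = k-th (weak) derivative, k <= 4.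
   w belongs to W^{4,1}[0,L] iff w, w', w'', w''' are absolutely continuous
   on [0,L], i.e. each d k (k < 4) is the indefinite integral of the
   integrable function d (k+1) on [0,L]. *)
Definition W41 (L : R) (d : nat -> R -> R) : Prop :=
  (forall k, (k <= 4)%N -> mu.-integrable `[0, L] (EFin \o d k)) /\
  (forall k, (k < 4)%N -> forall x, x \in `[0, L] ->
       d k x = d k 0 + int0 (d k.+1) x).

Definition bc (L : R) (d : nat -> R -> R) : Prop :=
  d 0%N 0 = 0 /\ d 0%N L = 0 /\ d 2%N 0 = 0 /\ d 2%N L = 0.

Definition opP (L a b c : R) (d : nat -> R -> R) (x : R) : R :=
  d 4%N x - (a + b * int0 (d 0%N) L) * d 2%N x + c * int0 (d 0%N) L.

Definition is_sol (L a b c : R) (p : R -> R) (d : nat -> R -> R) : Prop :=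
  W41 L d /\ bc L d /\
  {ae mu, forall x, x \in `]0, L[ -> opP L a b c d x = p x}.

Definition is_lower_sol (L a b c : R) (p : R -> R) (d : nat -> R -> R) : Prop :=
  W41 L d /\ bc L d /\
  {ae mu, forall x, x \in `]0, L[ -> opP L a b c d x <= p x}.

Definition is_upper_sol (L a b c : R) (p : R -> R) (d : nat -> R -> R) : Prop :=
  W41 L d /\ bc L d /\
  {ae mu, forall x, x \in `]0, L[ -> opP L a b c d x >= p x}.

Definition beta_d (L lam : R) (k : nat) (x : R) : R :=
  let w := pi / L in
  match k with
  | 0%N => lam * sin (w * x)
  | 1%N => lam * w * cos (w * x)
  | 2%N => - (lam * w ^+ 2 * sin (w * x))
  | 3%N => - (lam * w ^+ 3 * cos (w * x))
  | _ => lam * w ^+ 4 * sin (w * x)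
  end.

Definition zero_d (k : nat) (x : R) : R := 0.

Definition inS (L lam : R) (d : nat -> R -> R) : Prop :=
  forall x, x \in `[0, L] ->
    0 <= d 0%N x <= beta_d L lam 0 x /\ beta_d L lam 2 x <= d 2%N x <= 0.

Definition is_min_sol (L a b c lam : R) (p : R -> R) (d : nat -> R -> R) :=
  is_sol L a b c p d /\ inS L lam d /\
  forall u, is_sol L a b c p u -> inS L lam u ->
    forall x, x \in `[0, L] -> d 0%N x <= u 0%N x.

Definition is_max_sol (L a b c lam : R) (p : R -> R) (d : nat -> R -> R) :=
  is_sol L a b c p d /\ inS L lam d /\
  forall u, is_sol L a b c p u -> inS L lam u ->
    forall x, x \in `[0, L] -> u 0%N x <= d 0%N x.

Definition is_iteration (L a b c lam : R) (p : R -> R)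
    (y0 : nat -> R -> R) (Y : nat -> nat -> R -> R) : Prop :=
  let M := a + 2 * b * lam * L / pi in
  let N := c + b * lam * pi ^+ 2 / L ^+ 2 in
  (forall k x, x \in `[0, L] -> Y 0%N k x = y0 k x) /\
  forall n, (1 <= n)%N ->
    W41 L (Y n) /\ bc L (Y n) /\
    {ae mu, forall x, x \in `]0, L[ ->
       Y n 4%N x - M * Y n 2%N x + N * int0 (Y n 0%N) L =
       p x + b * Y n.-1 2%N x * int0 (Y n.-1 0%N) L
           - 2 * b * lam * (L / pi) * Y n.-1 2%N x
           + b * lam * (pi ^+ 2 / L ^+ 2) * int0 (Y n.-1 0%N) L}.

Definition unif_cvg_on (L : R) (f : nat -> R -> R) (y : R -> R) : Prop :=
  forall e : R, 0 < e -> exists n0 : nat, forall n, (n0 <= n)%N ->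
    forall x, x \in `[0, L] -> `|f n x - y x| < e.

End Defs.

(* Main.v *)
(** With [v = - y''], the linear problem [y'''' - m^2 y'' + N int y = h] becomes
    the Dirichlet problem [- v'' + m^2 v = h - N I], [I = int y].  Let [psi] and
    [gg] be the solutions with right-hand sides [1] and [x (L - x) / 2].  Then
    [I (1 + N J) = int h gg] with [J = int gg], so that [v >= 0] for every
    [h >= 0] as soon as [N psi(x) gg(s) <= (1 + N J) G(x, s)] for the Green
    kernel [G].  The elementary bound [psi(x) gg(s) <= kap G(x, s)] reduces this
    to [N (kap - J) <= 1], which is the condition on [sigma].

    Hence the linear problem is monotone for the order [0 <= u, u'' <= 0].  On
    the order interval below [beta] the right-hand side of the iteration is
    increasing, so the iterates starting at [0] and at [beta] are monotone.
    Their second derivatives and means converge, and dominated convergence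
    together with an [L^1] bound for the linear problem gives uniform
    convergence to a solution, which lies below (above) every other solution
    of the order interval. *)

Require Import Defs.
From HB Require Import structures.
From mathcomp Require Import all_boot all_order all_algebra.
From mathcomp Require Import all_classical all_reals all_analysis.
From mathcomp Require Import measurable_realfun ring lra.
Set Implicit Arguments.
Unset Strict Implicit.
Unset Printing Implicit Defensive.
Import Order.TTheory GRing.Theory Num.Theory.
Import numFieldNormedType.Exports.
Local Open Scope classical_set_scope.
Local Open Scope ring_scope.

(** * Absolutely continuous functions on [0, L] *)

Section AbsolutelyContinuous.
Variable R : realType.
Local Notation mu := (@lebesgue_measure R).
Implicit Types (L x y k : R) (f g F G : R -> R).

Lemma ae_imp (P Q : R -> Prop) : {ae mu, forall t, P t} ->
  (forall t, P t -> Q t) -> {ae mu, forall t, Q t}.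
Proof.
move=> h hPQ; have F := ae_filter_ringOfSetsType mu.
exact: (@filterS _ _ F P Q hPQ h).
Qed.

Lemma ae_imp2 (P Q S : R -> Prop) : {ae mu, forall t, P t} ->
  {ae mu, forall t, Q t} -> (forall t, P t -> Q t -> S t) ->
  {ae mu, forall t, S t}.
Proof.
move=> hP hQ h; have F := ae_filter_ringOfSetsType mu.
exact: (@filterS2 _ _ F P Q S h hP hQ).
Qed.

Definition Ig L f := mu.-integrable `[0, L] (EFin \o f).

Lemma Ig_eq L f g : {in `[0, L], f =1 g} -> Ig L f -> Ig L g.
Proof.
move=> fg; apply: eq_integrable => // x xL.
by rewrite /= fg //; move: xL; rewrite inE.
Qed.

Lemma Ig_cst L k : Ig L (fun=> k).
Proof.
apply: measurable_bounded_integrable => //.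
- rewrite [X in (X < _)%E]lebesgue_measure_itv /=.
  by case: ifPn => // _; rewrite -EFinB ltry.
- exact: bounded_cst.
Qed.

Lemma IgD L f g : Ig L f -> Ig L g -> Ig L (fun x => f x + g x).
Proof. by move=> hf hg; exact: (integrableD _ hf hg). Qed.

Lemma IgZ L k f : Ig L f -> Ig L (fun x => k * f x).
Proof. by move=> hf; exact: (integrableZl _ _ hf). Qed.

Lemma IgN L f : Ig L f -> Ig L (fun x => - f x).
Proof. by move=> hf; exact: (integrableN hf). Qed.

Lemma IgB L f g : Ig L f -> Ig L g -> Ig L (fun x => f x - g x).
Proof. by move=> hf hg; apply: IgD => //; exact: IgN. Qed.

Lemma Ig_norm L f : Ig L f -> Ig L (fun x => `|f x|).
Proof. by move=> hf; exact: (integrable_norm hf). Qed.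

Lemma Ig_measurable L f : Ig L f -> measurable_fun `[0, L] f.
Proof. by move=> hf; apply/measurable_EFinP; exact: measurable_int hf. Qed.

Lemma IgM L f G k : Ig L f -> measurable_fun `[0, L] G ->
  (forall x, x \in `[0, L] -> `|G x| <= k) -> Ig L (fun x => f x * G x).
Proof.
move=> hf mG bG; apply: (@integrableMl _ _ _ mu `[0, L] _ (EFin \o f) G) => //.
exists k; split; first exact: num_real.
by move=> M kM x /= xL; apply: le_trans (ltW kM); exact: bG.
Qed.

Lemma Ig_sub L f x y : 0 <= x -> y <= L -> Ig L f ->
  mu.-integrable `[x, y] (EFin \o f).
Proof.
move=> x0 yL; apply: integrableS => //.
by apply: subset_itvScc; rewrite bnd_simp.
Qed.

Lemma Ig_le L f x : x <= L -> Ig L f -> Ig x f.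
Proof. by move=> xL; exact: Ig_sub. Qed.

Lemma int0_0 f : int0 f 0 = 0.
Proof. by rewrite /int0 set_itv1 Rintegral_set1. Qed.

Lemma int0_cst k x : 0 <= x -> int0 (fun=> k) x = k * x.
Proof.
move=> x0; rewrite /int0 Rintegral_cst // [X in fine X]lebesgue_measure_itv /= lte_fin.
by case: ltgtP x0 => // [_ _|<- _] /=; rewrite ?subr0.
Qed.

Lemma int0D L f g x : x <= L -> Ig L f -> Ig L g ->
  int0 (fun t => f t + g t) x = int0 f x + int0 g x.
Proof. by move=> xL hf hg; rewrite /int0 RintegralD //; exact: Ig_le xL _. Qed.

Lemma int0Z L f k x : x <= L -> Ig L f ->
  int0 (fun t => k * f t) x = k * int0 f x.
Proof. by move=> xL hf; rewrite /int0 RintegralZl //; exact: Ig_le xL _. Qed.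

Lemma int0_eq f g x : {in `[0, x], f =1 g} -> int0 f x = int0 g x.
Proof. by move=> fg; apply: eq_Rintegral => t; rewrite inE => /fg. Qed.

Lemma int0N L f x : x <= L -> Ig L f ->
  int0 (fun t => - f t) x = - int0 f x.
Proof.
move=> xL hf; rewrite -mulN1r -(int0Z (-1) xL hf).
by apply: int0_eq => t _; rewrite mulN1r.
Qed.

Lemma int0B L f g x : x <= L -> Ig L f -> Ig L g ->
  int0 (fun t => f t - g t) x = int0 f x - int0 g x.
Proof.
by move=> xL hf hg; rewrite (int0D xL hf (IgN hg)) (int0N xL hg).
Qed.

Lemma int0_sub L f x y : 0 <= x -> x <= y -> y <= L -> Ig L f ->
  int0 f y - int0 f x = \int[mu]_(t in `]x, y]) f t.
Proof.
move=> x0 xy yL hf; rewrite /int0 Rintegral_itvB ?bnd_simp //.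
exact: Ig_sub hf.
Qed.

Lemma int0_nd L f x y : 0 <= x -> x <= y -> y <= L -> Ig L f ->
  {ae mu, forall t, t \in `]x, y[ -> 0 <= f t} -> int0 f x <= int0 f y.
Proof.
move=> x0 xy yL hf f0; rewrite -subr_ge0 (int0_sub x0 xy yL hf).
have ho : mu.-integrable `]x, y[ (EFin \o f).
  apply: integrableS (hf) => //.
  by move=> t; rewrite /= !in_itv /= => /andP[xt ty]; apply/andP; split; lra.
have -> : \int[mu]_(t in `]x, y]) f t = \int[mu]_(t in `]x, y[) f t.
  by rewrite -Rintegral_itv_bndo_bndc.
have mf := measurable_int _ ho.
(* As [f] is nonnegative only almost everywhere, it is traded for its absolute value, which is
   nonnegative at every point. *)
have -> : \int[mu]_(t in `]x, y[) f t = \int[mu]_(t in `]x, y[) `|f t|.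
  rewrite /Rintegral; congr fine; apply: ae_eq_integral => //.
  - have := measurable_int _ (integrable_norm ho); exact.
  - by apply: (ae_imp f0) => t ft /ft /= h; rewrite ger0_norm.
by apply: Rintegral_ge0 => t _.
Qed.

Lemma int0_le L f g x y : 0 <= x -> x <= y -> y <= L -> Ig L f -> Ig L g ->
  {ae mu, forall t, t \in `]x, y[ -> f t <= g t} ->
  int0 f y - int0 f x <= int0 g y - int0 g x.
Proof.
move=> x0 xy yL hf hg fg.
have h := @int0_nd L (fun t => g t - f t) x y x0 xy yL (IgB hg hf).
move: h; rewrite !(int0B _ hg hf) ?(le_trans xy) // => h.
suff : int0 g x - int0 f x <= int0 g y - int0 f y by lra.
by apply: h; apply: (ae_imp fg) => t ht /ht; rewrite subr_ge0.
Qed.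

Lemma int0_norm_le L f g x y : 0 <= x -> x <= y -> y <= L -> Ig L f -> Ig L g ->
  {ae mu, forall t, t \in `]x, y[ -> `|f t| <= g t} ->
  `|int0 f y - int0 f x| <= int0 g y - int0 g x.
Proof.
move=> x0 xy yL hf hg fg; rewrite ler_norml; apply/andP; split; last first.
  by apply: (int0_le x0 xy yL) => //; apply: (ae_imp fg) => t ht /ht /ler_normlP[].
rewrite lerNl; have xL := le_trans xy yL.
have := @int0_le L (fun t => - f t) g x y x0 xy yL (IgN hf) hg.
rewrite !(int0N _ hf) // => h.
suff : - int0 f y - - int0 f x <= int0 g y - int0 g x by lra.
by apply: h; apply: (ae_imp fg) => t ht /ht /ler_normlP[].
Qed.

Lemma int0_ae_eq L f g x : 0 <= x <= L -> Ig L f -> Ig L g ->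
  {ae mu, forall t, t \in `]0, x[ -> f t = g t} -> int0 f x = int0 g x.
Proof.
move=> /andP[x0 xL] hf hg fg; apply/eqP; rewrite eq_le.
have h1 := int0_le (lexx 0) x0 xL hf hg.
have h2 := int0_le (lexx 0) x0 xL hg hf.
move: h1 h2; rewrite !int0_0 !subr0 => h1 h2; apply/andP; split.
- by apply: h1; apply: (ae_imp fg) => t ht /ht ->.
- by apply: h2; apply: (ae_imp fg) => t ht /ht ->.
Qed.

(** [f] is a chosen representative of the almost everywhere derivative of [F], and [AC_ae] allows
    another choice. Chained pairs [AC L v v1], [AC L v1 v2] express second-order equations with
    integrable data. *)
Definition AC L F f :=
  [/\ Ig L F, Ig L f & forall x, x \in `[0, L] -> F x = F 0 + int0 f x].

Lemma mkAC L F f : 0 <= L -> Ig L f ->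
  (forall x, x \in `[0, L] -> F x = F 0 + int0 f x) -> AC L F f.
Proof.
move=> L0 hf hF; split=> //.
have : Ig L (fun x => F 0 + int0 f x).
  apply: IgD; first exact: Ig_cst.
  apply: continuous_compact_integrable; first exact: segment_compact.
  exact: parameterized_integral_continuous.
by apply: Ig_eq => x xL; rewrite [RHS]hF.
Qed.

Lemma AC_int0 L f k : 0 <= L -> Ig L f -> AC L (fun x => k + int0 f x) f.
Proof. by move=> L0 hf; apply: mkAC => // x _; rewrite int0_0 addr0. Qed.

Lemma AC_sub L F f x y : AC L F f -> 0 <= x <= L -> 0 <= y <= L ->
  F y - F x = int0 f y - int0 f x.
Proof. by move=> [_ _ hF] hx hy; rewrite hF // [in LHS](hF x) //; lra. Qed.

Lemma AC_eq L F f G g : {in `[0, L], F =1 G} -> {in `[0, L], f =1 g} ->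
  0 <= L -> AC L F f -> AC L G g.
Proof.
move=> FG fg L0 [iF iF' hF]; split; [exact: Ig_eq iF|exact: Ig_eq iF'|].
move=> x xL; rewrite -!FG // ?in_itv /= ?lexx // hF //; congr (_ + _).
apply: int0_eq => t /[!in_itv] /= /andP[t0 tx]; apply: fg.
by move: xL; rewrite !in_itv /= t0 => /andP[_]; exact: le_trans.
Qed.

Lemma AC_ae L F f g : Ig L g ->
  {ae mu, forall t, t \in `]0, L[ -> f t = g t} -> AC L F f -> AC L F g.
Proof.
move=> ig fg [iF iF' hF]; split=> // x xL; rewrite hF //; congr (_ + _).
apply: (@int0_ae_eq L) => //.
apply: (ae_imp fg) => t ht; rewrite in_itv /= => /andP[t0 tx]; apply: ht.
by move: xL; rewrite !in_itv /= t0 => /andP[_]; exact: lt_le_trans.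
Qed.

Lemma AC_cst L k : 0 <= L -> AC L (fun=> k) (fun=> 0).
Proof.
move=> L0; split; [exact: Ig_cst|exact: Ig_cst|].
by move=> x /andP[x0 _]; rewrite int0_cst ?mul0r ?addr0.
Qed.

Lemma ACD L F f G g : AC L F f -> AC L G g ->
  AC L (fun x => F x + G x) (fun x => f x + g x).
Proof.
move=> [iF jf hF] [iG jg hG]; split; [exact: IgD|exact: IgD|] => x xL.
rewrite hF // [in LHS]hG // (int0D _ jf jg); first by lra.
by move: xL => /andP[].
Qed.

Lemma ACZ L k F f : AC L F f -> AC L (fun x => k * F x) (fun x => k * f x).
Proof.
move=> [iF jf hF]; split; [exact: IgZ|exact: IgZ|] => x xL.
rewrite hF // (int0Z _ _ jf); first by lra.
by move: xL => /andP[].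
Qed.

Lemma ACN L F f : AC L F f -> AC L (fun x => - F x) (fun x => - f x).
Proof.
move=> [iF jf hF]; split; [exact: IgN|exact: IgN|] => x xL.
rewrite hF // (int0N _ jf); first by lra.
by move: xL => /andP[].
Qed.

Lemma ACB L F f G g : AC L F f -> AC L G g ->
  AC L (fun x => F x - G x) (fun x => f x - g x).
Proof. by move=> hF hG; apply: ACD => //; exact: ACN. Qed.

Lemma AC_bounded L F f : AC L F f -> forall x, x \in `[0, L] ->
  `|F x| <= `|F 0| + int0 (fun t => `|f t|) L.
Proof.
move=> [iF jf hF] x xL; rewrite hF //; move: xL => /andP[x0 xL].
apply: (le_trans (ler_normD _ _)); rewrite lerD2l.
have := int0_norm_le (lexx 0) x0 xL jf (Ig_norm jf).
rewrite !int0_0 !subr0 => h; apply: (le_trans (h _)); first exact: aeW.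
by apply: (int0_nd x0 xL (lexx L)); [exact: Ig_norm|exact: aeW].
Qed.

Lemma AC_nd L F f x y : AC L F f -> 0 <= x -> x <= y -> y <= L ->
  {ae mu, forall t, t \in `]x, y[ -> 0 <= f t} -> F x <= F y.
Proof.
move=> hF x0 xy yL f0; have [_ jf _] := hF.
rewrite -subr_ge0 (AC_sub hF) ?subr_ge0; last 2 first.
- by rewrite x0 (le_trans xy).
- by rewrite (le_trans x0).
exact: (int0_nd x0 xy yL jf f0).
Qed.

Lemma AC_smooth L F f : 0 < L -> (forall x, is_derive x 1 F (f x)) ->
  continuous f -> AC L F f.
Proof.
move=> L0 dF cf.
have jf : Ig L f.
  apply: continuous_compact_integrable; first exact: segment_compact.
  exact: continuous_subspaceT.
apply: mkAC => //; first exact: ltW.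
move=> x /andP[/=]; rewrite bnd_simp le_eqVlt => /predU1P[<- _|x0 xL].
  by rewrite int0_0 addr0.
have cF y : {for y, continuous F}.
  by apply: differentiable_continuous; apply/derivable1_diffP; have [] := dF y.
rewrite /int0 /Rintegral (@continuous_FTC2 _ f F) //.
- by rewrite -EFinB /= addrC subrK.
- exact: continuous_subspaceT.
- split; [by move=> y _; have [] := dF y| |].
  + exact: cvg_at_right_filter (cF _).
  + exact: cvg_at_left_filter (cF _).
- by move=> y _; rewrite derive1E; have [_] := dF y.
Qed.

End AbsolutelyContinuous.

(** * Product rule and Lagrange identity for absolutely continuous functions *)

Section ProductRule.
Variable R : realType.
Local Notation mu := (@lebesgue_measure R).
Implicit Types (L K x y : R) (f g F G : R -> R).

Lemma eq_of_norm_small (u v C : R) :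
  (forall n : nat, `|u - v| <= C / n.+1%:R) -> u = v.
Proof.
move=> h; apply/eqP; rewrite -subr_eq0 -normr_eq0; apply/contraT => ne0.
have e0 : 0 < `|u - v| by rewrite lt_def ne0 normr_ge0.
have [n hn] : exists n : nat, C / `|u - v| < n.+1%:R.
  exists (Num.bound `|C / `|u - v| |); apply: (le_lt_trans (ler_norm _)).
  by apply: (lt_trans (archi_boundP (normr_ge0 _))); rewrite ltr_nat.
have := h n; rewrite ler_pdivlMr ?ltr0n // leNgt.
by move: hn; rewrite ltr_pdivrMr // mulrC => ->.
Qed.

Section Increment.
Variables (L K : R) (F f G g : R -> R).
Hypotheses (hF : AC L F f) (hG : AC L G g).
Hypothesis bg : forall x, x \in `[0, L] -> `|g x| <= K.

Let w t := f t * G t + F t * g t.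
Let A x := int0 (fun t => `|f t|) x.
Let D x := F x * G x - int0 w x.

Let Iw : Ig L w.
Proof.
have [iF jf _] := hF; have [iG jg _] := hG; apply: IgD.
- exact: IgM jf (Ig_measurable iG) (AC_bounded hG).
- exact: IgM iF (Ig_measurable jg) bg.
Qed.

(* [D y - D x] is the integral over [x, y] of [f (G y - G) + (F x - F) g],
   in which both summands are small. *)
Let D_increment x y : 0 <= x -> x <= y -> y <= L ->
  `|D y - D x| <= 2 * K * (y - x) * (A y - A x).
Proof.
move=> x0 xy yL; have [iF jf _] := hF; have [iG jg _] := hG.
have xL := le_trans xy yL; have y0 := le_trans x0 xy.
have K0 : 0 <= K.
  by apply: le_trans (normr_ge0 _) (bg (x := x) _); rewrite in_itv /= x0.
pose v t := G y * f t + F x * g t.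
have iv : Ig L v by apply: IgD; exact: IgZ.
(* [W] dominates the integrand, since |G y - G t| <= K (y - x) and |F t - F x| <= A y - A x. Each
   term integrates to K (y - x) (A y - A x) over [x, y], hence the factor 2. *)
pose W t := K * (y - x) * `|f t| + K * (A y - A x).
have iW : Ig L W by apply: IgD; [apply: IgZ; exact: Ig_norm|exact: Ig_cst].
have vE z : z <= L -> int0 v z = G y * int0 f z + F x * int0 g z.
  move=> zL; rewrite (int0D zL (IgZ _ jf) (IgZ _ jg)).
  by rewrite (int0Z _ zL jf) (int0Z _ zL jg).
have WE z : 0 <= z -> z <= L -> int0 W z = K * (y - x) * A z + K * (A y - A x) * z.
  move=> z0 zL; rewrite (int0D zL (IgZ _ (Ig_norm jf)) (Ig_cst _ _)).
  by rewrite (int0Z _ zL (Ig_norm jf)) int0_cst.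
have := @int0_norm_le R L (fun t => v t - w t) W x y x0 xy yL (IgB iv Iw) iW.
rewrite !(int0B _ iv Iw) // !vE // !WE // => h.
have Fxy : F y - F x = int0 f y - int0 f x by apply: (AC_sub hF); lra.
have Gxy : G y - G x = int0 g y - int0 g x by apply: (AC_sub hG); lra.
have -> : D y - D x = G y * int0 f y + F x * int0 g y - int0 w y -
    (G y * int0 f x + F x * int0 g x - int0 w x).
  rewrite /D; move: Fxy Gxy; move: (int0 f y) (int0 f x) (int0 g y) (int0 g x).
  move=> a b c d /eqP + /eqP; rewrite subr_eq => /eqP -> /eqP.
  by move=> /(canRL (subrK _)) ->; ring.
apply: (le_trans (h _)); last by rewrite le_eqVlt; apply/orP; left; apply/eqP; ring.
apply: aeW => t; rewrite in_itv /= => /andP[xt ty].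
have t0 : 0 <= t by lra.
have tL : t <= L by lra.
have -> : v t - w t = f t * (G y - G t) - (F t - F x) * g t by rewrite /v /w; ring.
apply: (le_trans (ler_normB _ _)); rewrite !normrM; apply: lerD.
  rewrite [leRHS]mulrC; apply: ler_wpM2l => //.
  rewrite (AC_sub hG) ?t0 ?y0 //.
  have := int0_norm_le t0 (ltW ty) yL jg (Ig_cst L K).
  rewrite !int0_cst // => hh; apply: (le_trans (hh _)).
    apply: aeW => s; rewrite in_itv /= => /andP[s1 s2].
    by apply: bg; rewrite in_itv /=; lra.
  by rewrite -mulrBr; apply: ler_wpM2l => //; lra.
rewrite mulrC; apply: ler_pM => //; first by apply: bg; rewrite in_itv /= t0.
rewrite (AC_sub hF) ?t0 ?x0 //.
have := int0_norm_le x0 (ltW xt) tL jf (Ig_norm jf) => hh.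
apply: (le_trans (hh _)); first exact: aeW.
rewrite lerD2r; apply: (int0_nd t0 (ltW ty) yL (Ig_norm jf)).
exact: aeW.
Qed.

(** Cut [0, x] into [n.+1] pieces of length h = x / (n + 1). By telescoping of [A], the increments
    of [D] add up to at most 2 K h A(x), which tends to 0 with h. *)
Let D_cst x : x \in `[0, L] -> D x = D 0.
Proof.
rewrite in_itv /= => /andP[x0 xL].
apply: (@eq_of_norm_small _ _ (2 * K * x * A x)) => n.
pose h := x / n.+1%:R.
have h0 : 0 <= h by rewrite divr_ge0.
have hn : h * n.+1%:R = x by rewrite /h divfK.
have H (i : nat) : (i <= n.+1)%N -> `|D (h * i%:R) - D 0| <= 2 * K * h * A (h * i%:R).
  elim: i => [_|i IH ltin].
    by rewrite mulr0 subrr normr0 /A int0_0 mulr0.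
  have le1 : h * i%:R <= h * i.+1%:R by rewrite ler_wpM2l // ler_nat.
  have le2 : h * i.+1%:R <= L.
    by apply: le_trans xL; rewrite -hn ler_wpM2l // ler_nat.
  have := D_increment (mulr_ge0 h0 (ler0n _ _)) le1 le2.
  have -> : h * i.+1%:R - h * i%:R = h by rewrite -natr1 mulrDr mulr1 addrC addKr.
  have := IH (ltnW ltin).
  have -> : D (h * i.+1%:R) - D 0 =
    (D (h * i.+1%:R) - D (h * i%:R)) + (D (h * i%:R) - D 0) by ring.
  move=> e1 e2; apply: (le_trans (ler_normD _ _)).
  by apply: (le_trans (lerD e2 e1)); rewrite -mulrDr subrK.
have := H n.+1 (leqnn _); rewrite hn => /le_trans; apply.
by rewrite le_eqVlt; apply/orP; left; apply/eqP; rewrite /h; ring.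
Qed.

Lemma ACM : 0 <= L ->
  AC L (fun x => F x * G x) (fun x => f x * G x + F x * g x).
Proof.
move=> L0; apply: mkAC => // x xL; have := D_cst xL.
by rewrite /D int0_0 subr0 => <-; rewrite subrK.
Qed.

End Increment.

(** The terms v' u' of the two product rules cancel. Boundedness is asked of [u2] only, so [v2] may
    be merely integrable, as fourth derivatives of solutions are. *)
Lemma AC_Lagrange L K v v1 v2 u u1 u2 : 0 <= L ->
  AC L v v1 -> AC L v1 v2 -> AC L u u1 -> AC L u1 u2 ->
  (forall x, x \in `[0, L] -> `|u2 x| <= K) ->
  AC L (fun x => v1 x * u x - v x * u1 x) (fun x => v2 x * u x - v x * u2 x).
Proof.
move=> L0 hv hv1 hu hu1 bu.
have h1 := ACM hv1 hu (AC_bounded hu1) L0.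
have h2 := ACM hv hu1 bu L0.
by apply: AC_eq (ACB h1 h2) => // x _; ring.
Qed.

End ProductRule.

(** * Hyperbolic functions *)

Section Hyperbolic.
Variable R : realType.
Implicit Types x y k l L : R.

Lemma sinhR0 : sinhR (0 : R) = 0.
Proof. by rewrite /sinhR oppr0 subrr mul0r. Qed.

Lemma coshR0 : coshR (0 : R) = 1.
Proof. by rewrite /coshR oppr0 expR0; field. Qed.

Lemma sinhRD x y : sinhR (x + y) = sinhR x * coshR y + coshR x * sinhR y.
Proof. by rewrite /sinhR /coshR opprD !expRD; field. Qed.

Lemma coshRD x y : coshR (x + y) = coshR x * coshR y + sinhR x * sinhR y.
Proof. by rewrite /sinhR /coshR opprD !expRD; field. Qed.

Lemma sinhRN x : sinhR (- x) = - sinhR x.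
Proof. by rewrite /sinhR opprK; field. Qed.

Lemma coshRN x : coshR (- x) = coshR x.
Proof. by rewrite /coshR opprK addrC. Qed.

Lemma coshR2B x : coshR x * coshR x - sinhR x * sinhR x = 1.
Proof.
by have := coshRD x (- x); rewrite subrr coshR0 coshRN sinhRN => ->; ring.
Qed.

Lemma sinhR_ge0 x : 0 <= x -> 0 <= sinhR x.
Proof.
by move=> x0; rewrite divr_ge0 // subr_ge0 ler_expR; lra.
Qed.

Lemma sinhR_gt0 x : 0 < x -> 0 < sinhR x.
Proof.
by move=> x0; rewrite divr_gt0 // subr_gt0 ltr_expR; lra.
Qed.

Lemma coshR_gt0 x : 0 < coshR x.
Proof. by rewrite divr_gt0 // addr_gt0 // expR_gt0. Qed.

Lemma coshR_ge1 x : 1 <= coshR x.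
Proof.
have := coshR2B x; have := coshR_gt0 x.
have := sqr_ge0 (sinhR x); rewrite expr2.
by move: (coshR x) (sinhR x) => c s; nra.
Qed.

Lemma is_derive_sinhR_lin k l x :
  is_derive x 1 (fun t => sinhR (k * t + l)) (k * coshR (k * x + l)).
Proof.
rewrite /sinhR /coshR; apply: is_derive_eq.
by rewrite /GRing.scale /=; field.
Qed.

Lemma is_derive_coshR_lin k l x :
  is_derive x 1 (fun t => coshR (k * t + l)) (k * sinhR (k * x + l)).
Proof.
rewrite /sinhR /coshR; apply: is_derive_eq.
by rewrite /GRing.scale /=; field.
Qed.

Lemma continuous_is_derive (F f : R -> R) :
  (forall x, is_derive x 1 F (f x)) -> continuous F.
Proof.
move=> dF y; apply: differentiable_continuous.
by apply/derivable1_diffP; have [] := dF y.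
Qed.

Lemma AC_sinhR_lin L k l : 0 < L ->
  AC L (fun t => sinhR (k * t + l)) (fun t => k * coshR (k * t + l)).
Proof.
move=> L0; apply: AC_smooth => //; first exact: is_derive_sinhR_lin.
move=> x; apply: cvgM; first exact: cvg_cst.
exact: (continuous_is_derive (is_derive_coshR_lin k l)).
Qed.

Lemma AC_coshR_lin L k l : 0 < L ->
  AC L (fun t => coshR (k * t + l)) (fun t => k * sinhR (k * t + l)).
Proof.
move=> L0; apply: AC_smooth => //; first exact: is_derive_coshR_lin.
move=> x; apply: cvgM; first exact: cvg_cst.
exact: (continuous_is_derive (is_derive_sinhR_lin k l)).
Qed.

Lemma sinhR_ge x : 0 <= x -> x <= sinhR x.
Proof.
rewrite le_eqVlt => /predU1P[<-|x0]; first by rewrite sinhR0.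
have hS : AC x (fun t => sinhR (1 * t + 0) - t)
               (fun t => 1 * coshR (1 * t + 0) - 1).
  apply: ACB; first exact: AC_sinhR_lin.
  by apply: AC_smooth => // y; exact: cvg_cst.
have := AC_nd hS (lexx _) (ltW x0) (lexx _).
rewrite !mul1r !addr0 sinhR0 subr0 subr_ge0; apply; apply: aeW => t _.
by rewrite mul1r subr_ge0 coshR_ge1.
Qed.

(** The function t cosh t - sinh t vanishes at 0 and has derivative t sinh t >= 0. *)
Lemma sinhR_le_Mcosh x : 0 <= x -> sinhR x <= x * coshR x.
Proof.
rewrite le_eqVlt => /predU1P[<-|x0]; first by rewrite sinhR0 mul0r.
have h1 := AC_sinhR_lin 1 0 x0; have h2 := AC_coshR_lin 1 0 x0.
have hid : AC x (@id R) (fun=> 1).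
  by apply: AC_smooth => // y; exact: cvg_cst.
have h2' := ACM hid h2.
have [K bK] : exists K, forall t, t \in `[0, x] -> `|1 * sinhR (1 * t + 0)| <= K.
  by eexists => t; rewrite mul1r; exact: AC_bounded h1 t.
have := AC_nd (ACB (h2' K bK (ltW x0)) h1) (lexx _) (ltW x0) (lexx _).
rewrite !mul1r !addr0 sinhR0 mul0r subr0 subr_ge0; apply; apply: aeW => t.
rewrite in_itv /= => /andP[t0 _]; rewrite !mul1r addr0.
rewrite [X in 0 <= X](_ : _ = t * sinhR t); last by rewrite /=; ring.
by rewrite mulr_ge0 ?sinhR_ge0 // ltW.
Qed.

(** With y = x / 2, the left side is 2 sinh^2 y and the right side is 2 y sinh y cosh y, so
    [sinhR_le_Mcosh] at y suffices. *)
Lemma coshR_sub1_le x : 0 <= x -> coshR x - 1 <= x / 2 * sinhR x.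
Proof.
move=> x0; have y0 : 0 <= x / 2 by lra.
have xE : x = x / 2 + x / 2 by lra.
rewrite [in coshR x]xE [in sinhR x]xE coshRD sinhRD.
have := sinhR_le_Mcosh y0; have := sinhR_ge0 y0; have := coshR2B (x / 2).
by move: (x / 2) => y; move: (coshR y) (sinhR y) => c s; nra.
Qed.

End Hyperbolic.

(** * The Dirichlet problem for - v'' + m^2 v = q *)

Section Dirichlet.
Variable R : realType.
Local Notation mu := (@lebesgue_measure R).
Variables (L m : R).
Hypotheses (L0 : 0 < L) (m0 : 0 < m).

Local Notation S := (fun t : R => sinhR (m * t)).
Local Notation C := (fun t : R => coshR (m * t)).
Local Notation Sr := (fun t : R => sinhR (m * (L - t))).
Local Notation Cr := (fun t : R => coshR (m * (L - t))).

Lemma AC_sinh : AC L S (fun t => m * C t).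
Proof.
by apply: AC_eq (AC_sinhR_lin m 0 L0); rewrite ?ltW // => t _; rewrite addr0.
Qed.

Lemma AC_cosh : AC L C (fun t => m * S t).
Proof.
by apply: AC_eq (AC_coshR_lin m 0 L0); rewrite ?ltW // => t _; rewrite addr0.
Qed.

Lemma AC_sinhr : AC L Sr (fun t => - m * Cr t).
Proof.
have h t : m * (L - t) = - m * t + m * L by ring.
by apply: AC_eq (AC_sinhR_lin (- m) (m * L) L0); rewrite ?ltW // => t _; rewrite h.
Qed.

Lemma AC_coshr : AC L Cr (fun t => - m * Sr t).
Proof.
have h t : m * (L - t) = - m * t + m * L by ring.
by apply: AC_eq (AC_coshR_lin (- m) (m * L) L0); rewrite ?ltW // => t _; rewrite h.
Qed.

Lemma AC_dcosh : AC L (fun t => m * C t) (fun t => m * m * S t).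
Proof.
by apply: AC_eq (ACZ m AC_cosh) => [t _|t _|]; rewrite ?mulrA // ltW.
Qed.

Lemma AC_dcoshr : AC L (fun t => - m * Cr t) (fun t => m * m * Sr t).
Proof.
by apply: AC_eq (ACZ (- m) AC_coshr) => [//|t _|]; rewrite ?ltW //; ring.
Qed.

Lemma sinhr_expand x : sinhR (m * (L - x)) =
  sinhR (m * L) * coshR (m * x) - coshR (m * L) * sinhR (m * x).
Proof. by rewrite mulrBr sinhRD sinhRN coshRN; ring. Qed.

Lemma sinh_Wronskian x : coshR (m * (L - x)) * sinhR (m * x) +
  coshR (m * x) * sinhR (m * (L - x)) = sinhR (m * L).
Proof.
have -> : m * L = m * (L - x) + m * x by ring.
by rewrite [RHS]sinhRD; ring.
Qed.

Lemma IgM_AC q u u1 : Ig L q -> AC L u u1 -> Ig L (fun t => q t * u t).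
Proof.
by move=> iq hu; have [iu _ _] := hu; exact: IgM iq (Ig_measurable iu) (AC_bounded hu).
Qed.

Lemma AC_Lagrange_M v v1 v2 u u1 (q : R -> R) :
  AC L v v1 -> AC L v1 v2 -> Ig L q ->
  {ae mu, forall x, x \in `]0, L[ -> m * m * v x - v2 x = q x} ->
  AC L u u1 -> AC L u1 (fun t => m * m * u t) ->
  AC L (fun x => v1 x * u x - v x * u1 x) (fun x => - (q x * u x)).
Proof.
move=> hv hv1 iq eq hu hu1.
have hmu := ACZ (m * m) hu.
have := AC_Lagrange (ltW L0) hv hv1 hu hu1 (AC_bounded hmu).
apply: AC_ae; first by apply: IgN; exact: IgM_AC hu.
by apply: (ae_imp eq) => t /[apply] <-; ring.
Qed.

(** The Lagrange identity is applied on [0, x] with sinh(m t), and on [x, L] with sinh(m (L - t)),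
    each vanishing at its outer endpoint. Combining the two eliminates v'(x), and [sinh_Wronskian]
    gives the factor of v(x). *)
Lemma green_repr v v1 v2 (q : R -> R) :
  AC L v v1 -> AC L v1 v2 -> v 0 = 0 -> v L = 0 -> Ig L q ->
  {ae mu, forall x, x \in `]0, L[ -> m * m * v x - v2 x = q x} ->
  forall x, x \in `[0, L] ->
  m * sinhR (m * L) * v x = Sr x * int0 (fun t => q t * S t) x +
    S x * (int0 (fun t => q t * Sr t) L - int0 (fun t => q t * Sr t) x).
Proof.
move=> hv hv1 v0 vL iq eq x xL.
have h1 := AC_Lagrange_M hv hv1 iq eq AC_sinh AC_dcosh.
have h2 := AC_Lagrange_M hv hv1 iq eq AC_sinhr AC_dcoshr.
have iqS := IgM_AC iq AC_sinh; have iqSr := IgM_AC iq AC_sinhr.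
have LL : 0 <= L <= L by rewrite lexx ltW.
have L00 : 0 <= (0 : R) <= L by rewrite lexx ltW.
have xL' : 0 <= x <= L by move: xL; rewrite in_itv.
have := AC_sub h1 L00 xL'; have := AC_sub h2 xL' LL.
case/andP: xL' => x0' xL'.
rewrite !(int0N _ iqS) ?(int0N _ iqSr) // ?ltW // int0_0.
rewrite v0 vL subrr !mulr0 sinhR0 -(sinh_Wronskian x).
move: (int0 (fun t => q t * Sr t) x) (int0 (fun t => q t * Sr t) L).
move: (int0 (fun t => q t * S t) x) => c a b e1 e2.
have -> : b - a = v1 x * Sr x + v x * (m * Cr x).
  by rewrite /=; move: e1; rewrite /=; lra.
have -> : c = v x * (m * C x) - v1 x * S x by move: e2; rewrite /=; lra.
by rewrite /=; ring.
Qed.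

(** Variation of constants gives [z] with z'' = m^2 z + q and z(0) = 0. Then v = A sinh(m x) - z,
    with [A] chosen to cancel z(L). *)
Lemma dirichlet_exists (q : R -> R) : Ig L q -> exists v v1,
  [/\ AC L v v1, AC L v1 (fun x => m * m * v x - q x), v 0 = 0 & v L = 0].
Proof.
move=> iq.
have s0 : sinhR (m * L) != 0 by rewrite gt_eqF // sinhR_gt0 // mulr_gt0.
have m_neq0 : m != 0 by rewrite gt_eqF.
have L0' := ltW L0.
have hE1 := AC_int0 0 L0' (IgM_AC iq AC_cosh).
have hE2 := AC_int0 0 L0' (IgM_AC iq AC_sinh).
set E1 := (fun x => _) in hE1; set E2 := (fun x => _) in hE2.
have bC := AC_bounded (ACZ m AC_cosh); have bS := AC_bounded (ACZ m AC_sinh).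
have hz := ACZ m^-1 (ACB (ACM hE1 AC_sinh bC L0') (ACM hE2 AC_cosh bS L0')).
have hz1 := ACB (ACM hE1 AC_cosh bS L0') (ACM hE2 AC_sinh bC L0').
pose z x := m^-1 * (E1 x * S x - E2 x * C x).
pose z1 x := E1 x * C x - E2 x * S x.
have {}hz : AC L z z1.
  by apply: AC_eq hz => // t _; rewrite /z1 /=; field.
have {}hz1 : AC L z1 (fun x => m * m * z x + q x).
  apply: AC_eq hz1 => // t _; rewrite /z /=.
  rewrite -[in RHS](mulr1 (q t)) -(coshR2B (m * t)).
  by move: (E1 t) (E2 t) => e1 e2; field.
have z0 : z 0 = 0 by rewrite /z /E1 /E2 !int0_0 addr0; ring.
pose A := z L / sinhR (m * L).
exists (fun x => A * S x - z x), (fun x => A * (m * C x) - z1 x); split.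
- exact: ACB (ACZ _ AC_sinh) hz.
- by apply: AC_eq (ACB (ACZ A AC_dcosh) hz1) => // t _; ring.
- by rewrite mulr0 sinhR0 z0; ring.
- by rewrite /A divfK // subrr.
Qed.

(** The derivative [y1] is nonincreasing. If y1(x) >= 0, then y increases from 0 on [0, x];
    otherwise it decreases to 0 on [x, L]. *)
Lemma concave_ge0 y y1 y2 :
  AC L y y1 -> AC L y1 y2 -> y 0 = 0 -> y L = 0 ->
  {ae mu, forall x, x \in `]0, L[ -> y2 x <= 0} ->
  forall x, x \in `[0, L] -> 0 <= y x.
Proof.
move=> hy hy1 y0 yL y2le x; rewrite in_itv /= => /andP[x0 xL].
have ni s t : 0 <= s -> s <= t -> t <= L -> y1 t <= y1 s.
  move=> s0 st tL; rewrite -lerN2; apply: (AC_nd (ACN hy1) s0 st tL).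
  apply: (ae_imp y2le) => r h; rewrite in_itv /= => /andP[sr rt].
  by rewrite oppr_ge0; apply: h; rewrite in_itv /=; lra.
have [h|/ltW h] := leP 0 (y1 x).
  rewrite -y0; apply: (AC_nd hy (lexx _) x0 xL); apply: aeW => t.
  rewrite in_itv /= => /andP[t0 tx]; apply: (le_trans h); apply: ni; lra.
rewrite -lerN2 oppr0 -(oppr0) -yL; apply: (AC_nd (ACN hy) x0 xL (lexx L)).
apply: aeW => t; rewrite in_itv /= => /andP[xt tL].
by rewrite oppr_ge0; apply: le_trans h; apply: ni; lra.
Qed.

End Dirichlet.

(** * Comparison of the Green kernel with a product *)

Section LinearProblem.
Variable R : realType.
Local Notation mu := (@lebesgue_measure R).
Variables (L m : R).
Hypotheses (L0 : 0 < L) (m0 : 0 < m).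

Local Notation S := (fun t : R => sinhR (m * t)).
Local Notation C := (fun t : R => coshR (m * t)).
Local Notation Sr := (fun t : R => sinhR (m * (L - t))).
Local Notation s0 := (sinhR (m * L)).
Local Notation c0 := (coshR (m * L)).

Let m_neq0 : m != 0. Proof. by rewrite gt_eqF. Qed.
Let s0_gt0 : 0 < s0. Proof. by rewrite sinhR_gt0 // mulr_gt0. Qed.
Let s0_neq0 : s0 != 0. Proof. by rewrite gt_eqF. Qed.
Let L0' : 0 <= L. Proof. exact: ltW. Qed.

(* [torsion] solves [- u'' = 1], [psi] solves [- psi'' + m^2 psi = 1] and [gg]
   solves [- gg'' + m^2 gg = torsion], all with zero boundary values. *)
Definition torsion (t : R) := t * (L - t) / 2.
Definition psi (t : R) := (1 - C t + (c0 - 1) / s0 * S t) / (m * m).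
Definition psi1 (t : R) := (c0 - 1) / s0 * (C t / m) - S t / m.
Definition gg (t : R) := (torsion t - psi t) / (m * m).
Definition gg1 (t : R) := (L / 2 - t - psi1 t) / (m * m).

Lemma AC_id : AC L (@id R) (fun=> 1).
Proof. by apply: AC_smooth => // x; exact: cvg_cst. Qed.

Lemma AC_dtorsion : AC L (fun t => L / 2 - t) (fun=> -1).
Proof. by apply: AC_eq (ACB (AC_cst (L / 2) L0') AC_id) => // t _; rewrite sub0r. Qed.

Lemma AC_torsion : AC L torsion (fun t => L / 2 - t).
Proof.
have b1 t : t \in `[0, L] -> `|(fun=> 1 : R) t| <= 1 by rewrite normr1.
have h := ACB (ACZ (L / 2) AC_id) (ACZ 2^-1 (ACM AC_id AC_id b1 L0')).
by apply: AC_eq h => // t _; rewrite /torsion /=; field.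
Qed.

Lemma AC_psi : AC L psi psi1.
Proof.
have h := ACZ (m * m)^-1 (ACD (ACB (AC_cst 1 L0') (AC_cosh m L0))
  (ACZ ((c0 - 1) / s0) (AC_sinh m L0))).
by apply: AC_eq h => // t _; rewrite /psi /psi1; field; rewrite m_neq0 s0_neq0.
Qed.

Lemma AC_psi1 : AC L psi1 (fun t => m * m * psi t - 1).
Proof.
have h := ACB (ACZ ((c0 - 1) / s0 / m) (AC_cosh m L0)) (ACZ m^-1 (AC_sinh m L0)).
by apply: AC_eq h => // t _; rewrite /psi /psi1; field; rewrite m_neq0 s0_neq0.
Qed.

Lemma AC_gg : AC L gg gg1.
Proof.
have h := ACZ (m * m)^-1 (ACB AC_torsion AC_psi).
by apply: AC_eq h => // t _; rewrite /gg /gg1 mulrC.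
Qed.

Lemma AC_gg1 : AC L gg1 (fun t => m * m * gg t - torsion t).
Proof.
have h := ACZ (m * m)^-1 (ACB AC_dtorsion AC_psi1).
by apply: AC_eq h => // t _; rewrite /gg /gg1; field.
Qed.

Lemma torsion0 : torsion 0 = 0. Proof. by rewrite /torsion !mul0r. Qed.
Lemma torsionL : torsion L = 0. Proof. by rewrite /torsion subrr mulr0 mul0r. Qed.

(** The addition formula makes the symmetry of [psi] under x -> L - x visible; the bounds on [psi]
    also start from this form. *)
Lemma psi_sym_expr x : m * m * s0 * psi x = s0 - S x - Sr x.
Proof. by rewrite /psi /= sinhr_expand; field; rewrite m_neq0 s0_neq0. Qed.

Lemma psi0 : psi 0 = 0.
Proof. by rewrite /psi mulr0 coshR0 sinhR0; ring. Qed.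

Lemma psiL : psi L = 0.
Proof. by rewrite /psi; field; rewrite m_neq0 s0_neq0. Qed.

Lemma gg0 : gg 0 = 0. Proof. by rewrite /gg torsion0 psi0 subrr mul0r. Qed.
Lemma ggL : gg L = 0. Proof. by rewrite /gg torsionL psiL subrr mul0r. Qed.

Lemma psi_sym x : psi (L - x) = psi x.
Proof.
have h : m * m * s0 != 0 by rewrite mulf_neq0 // mulf_neq0.
apply: (mulfI h); rewrite !psi_sym_expr /=.
have -> : L - (L - x) = x by ring.
by ring.
Qed.

Lemma gg_sym x : gg (L - x) = gg x.
Proof. by rewrite /gg psi_sym /torsion; congr ((_ - _) / _); field. Qed.

Lemma sinh_ge0 x : 0 <= x -> 0 <= S x.
Proof. by move=> x0; rewrite sinhR_ge0 // mulr_ge0 // ltW. Qed.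

Lemma sinhr_ge0 x : x <= L -> 0 <= Sr x.
Proof. by move=> x0; rewrite sinhR_ge0 // mulr_ge0 ?subr_ge0 // ltW. Qed.

(** By [sinh_Wronskian] and cosh >= 1, S x + Sr x <= s0. *)
Lemma psi_ge0 x : x \in `[0, L] -> 0 <= psi x.
Proof.
rewrite in_itv /= => /andP[x0 xL].
have h : 0 < m * m * s0 by rewrite mulr_gt0 // mulr_gt0.
rewrite -(pmulr_rge0 _ h) psi_sym_expr /= -(sinh_Wronskian L m x).
have := sinh_ge0 x0; have := sinhr_ge0 xL => /=.
have := coshR_ge1 (m * (L - x)); have := coshR_ge1 (m * x).
by move: (coshR _) (coshR _) (sinhR _) (sinhR _) => a b c d; nra.
Qed.

Lemma psi_le x : m * m * s0 * psi x <= (c0 - 1) * S x.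
Proof.
rewrite psi_sym_expr sinhr_expand /=; have := coshR_ge1 (m * x).
by move: s0_gt0; move: s0 c0 (sinhR (m * x)) (coshR (m * x)) => a b c d; nra.
Qed.

Lemma psi_ler x : m * m * s0 * psi x <= (c0 - 1) * Sr x.
Proof. by rewrite -psi_sym; exact: psi_le. Qed.

(** Since gg'' = - psi <= 0, [gg] is concave and vanishes at both ends. *)
Lemma gg_ge0 x : x \in `[0, L] -> 0 <= gg x.
Proof.
apply: (concave_ge0 AC_gg AC_gg1 gg0 ggL); apply: aeW => t.
rewrite in_itv /= => /andP[t0 tL].
have -> : m * m * gg t - torsion t = - psi t by rewrite /gg; field.
by rewrite oppr_le0 psi_ge0 // in_itv /= !ltW.
Qed.

(* [gam = m gg'(0)], the slope of the comparison [gg <= gg'(0) sinh(m s) / m]. *)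
Definition gam := L / 2 / m - (c0 - 1) / s0 / (m * m).

Lemma gg_le s : s \in `[0, L] -> m * m * gg s <= gam * S s.
Proof.
rewrite in_itv /= => /andP[s0' sL].
(* With u = m s and w = m L, the last bracket is (w - u) (sinh u - u) / 2 plus u sinh u / 2 - (cosh
   u - 1). The first is nonnegative as u <= w, the second by [coshR_sub1_le]. *)
have -> : gam * S s = m * m * gg s +
    (m * m)^-1 * (m * L / 2 * (S s - m * s) + m * s * (m * s) / 2 - (C s - 1)).
  by rewrite /gam /gg /psi /torsion; field; rewrite m_neq0 s0_neq0.
rewrite lerDl /=; apply: mulr_ge0; first by rewrite invr_ge0 mulr_ge0 // ltW.
have ms0 : 0 <= m * s by rewrite mulr_ge0 // ltW.
have := sinhR_ge ms0; have := coshR_sub1_le ms0.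
have : m * s <= m * L by rewrite ler_wpM2l // ltW.
move: (m * s) ms0 => u u0; move: (m * L) (sinhR u) (coshR u) => w a b uw ba ua.
have : 0 <= (w - u) * (a - u) by rewrite mulr_ge0 ?subr_ge0.
by lra.
Qed.

Lemma gg_ler s : s \in `[0, L] -> m * m * gg s <= gam * Sr s.
Proof.
move=> sL; rewrite -gg_sym; apply: gg_le.
by move: sL; rewrite !in_itv /= => /andP[? ?]; apply/andP; split; lra.
Qed.

(* The best constant in [psi(x) gg(s) <= kap G(x, s)], [G] being the Green
   kernel of [- v'' + m^2 v] with zero boundary values; it is approached at the
   corner [x = L], [s = 0] of the square. *)
Definition kap := (c0 - 1) * gam / (m * m * m).

(** The pair [a], [b] stands for Sr x, S s when s <= x and for S x, Sr s when s >= x. In both cases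
    a b = m s0 G(x, s), and the bound is the product of the two one-variable estimates. *)
Lemma kernel_le a b x s : x \in `[0, L] -> s \in `[0, L] ->
  m * m * s0 * psi x <= (c0 - 1) * a -> m * m * gg s <= gam * b ->
  m * s0 * psi x * gg s <= kap * (a * b).
Proof.
move=> hx hs h1 h2.
have H : (m * m * s0 * psi x) * (m * m * gg s) <= ((c0 - 1) * a) * (gam * b).
  apply: ler_pM => //.
    exact: (mulr_ge0 (ltW (mulr_gt0 (mulr_gt0 m0 m0) s0_gt0)) (psi_ge0 hx)).
  exact: (mulr_ge0 (ltW (mulr_gt0 m0 m0)) (gg_ge0 hs)).
have m3 : 0 < m * m * m by rewrite !mulr_gt0.
rewrite -(ler_pM2l m3); apply: le_trans (_ : _ <= (c0 - 1) * a * (gam * b)) _.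
  by apply: le_trans H; rewrite le_eqVlt; apply/orP; left; apply/eqP; ring.
by rewrite le_eqVlt; apply/orP; left; apply/eqP; rewrite /kap; field.
Qed.

(* [m s0] times the solution of [- v'' + m^2 v = q], [v(0) = v(L) = 0]. *)
Definition greenop (q : R -> R) x := Sr x * int0 (fun t => q t * S t) x +
  S x * (int0 (fun t => q t * Sr t) L - int0 (fun t => q t * Sr t) x).

Lemma psi_green x : x \in `[0, L] -> m * s0 * psi x = greenop (fun=> 1) x.
Proof.
apply: (green_repr L0 AC_psi AC_psi1 psi0 psiL (Ig_cst _ _)).
by apply: aeW => t _; ring.
Qed.

Section Positive.
Variable h : R -> R.
Hypotheses (ih : Ig L h).
Hypothesis h_ge0 : {ae mu, forall x, x \in `]0, L[ -> 0 <= h x}.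

Let ihS : Ig L (fun t => h t * S t).
Proof. exact: IgM_AC ih (AC_sinh m L0). Qed.
Let ihSr : Ig L (fun t => h t * Sr t).
Proof. exact: IgM_AC ih (AC_sinhr m L0). Qed.
Let ihg : Ig L (fun t => h t * gg t).
Proof. exact: IgM_AC ih AC_gg. Qed.

Lemma greenop_ge0 x : x \in `[0, L] -> 0 <= greenop h x.
Proof.
rewrite in_itv /= => /andP[x0 xL]; rewrite addr_ge0 //.
  rewrite mulr_ge0 ?sinhr_ge0 // -(int0_0 (fun t => h t * S t)).
  apply: (int0_nd (lexx _) x0 xL ihS); apply: (ae_imp h_ge0) => t ht.
  rewrite in_itv /= => /andP[t0 tx]; rewrite mulr_ge0 //; last by rewrite sinh_ge0 // ltW.
  by apply: ht; rewrite in_itv /= t0 (lt_le_trans tx).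
rewrite mulr_ge0 ?sinh_ge0 // subr_ge0.
apply: (int0_nd x0 xL (lexx _) ihSr); apply: (ae_imp h_ge0) => t ht.
rewrite in_itv /= => /andP[xt tL]; rewrite mulr_ge0 //; last by rewrite sinhr_ge0 // ltW.
by apply: ht; rewrite in_itv /= tL andbT (le_lt_trans x0).
Qed.

(** [kernel_le] is integrated against h >= 0 on [0, x] and on [x, L] separately, the kernel changing
    its form at x. *)
Lemma greenop_lower x : x \in `[0, L] ->
  m * s0 * psi x * int0 (fun t => h t * gg t) L <= kap * greenop h x.
Proof.
move=> hx; have := hx; rewrite in_itv /= => /andP[x0 xL].
set P := m * s0 * psi x.
have e1 : P * int0 (fun t => h t * gg t) x <=
          kap * Sr x * int0 (fun t => h t * S t) x.
  rewrite -(int0Z _ xL ihg) -(int0Z _ xL ihS).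
  have := int0_le (lexx _) x0 xL (IgZ P ihg) (IgZ (kap * Sr x) ihS).
  rewrite !int0_0 !subr0; apply; apply: (ae_imp h_ge0) => t ht.
  rewrite in_itv /= => /andP[t0 tx].
  have htI : t \in `[0, L] by rewrite in_itv /=; lra.
  have ht0 : 0 <= h t by apply: ht; rewrite in_itv /=; lra.
  have := kernel_le hx htI (psi_ler x) (gg_le htI); rewrite -/P.
  by move: (gg t) (sinhR _) (sinhR _) => u v w; nra.
have e2 : P * (int0 (fun t => h t * gg t) L - int0 (fun t => h t * gg t) x) <=
    kap * S x * (int0 (fun t => h t * Sr t) L - int0 (fun t => h t * Sr t) x).
  rewrite !mulrBr -!(int0Z _ xL ihg) -!(int0Z _ xL ihSr).
  rewrite -!(int0Z _ (lexx L) ihg) -!(int0Z _ (lexx L) ihSr).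
  apply: (int0_le x0 xL (lexx L) (IgZ P ihg) (IgZ _ ihSr)).
  apply: (ae_imp h_ge0) => t ht; rewrite in_itv /= => /andP[xt tL].
  have htI : t \in `[0, L] by rewrite in_itv /=; lra.
  have ht0 : 0 <= h t by apply: ht; rewrite in_itv /=; lra.
  have := kernel_le hx htI (psi_le x) (gg_ler htI); rewrite -/P.
  by move: (gg t) (sinhR _) (sinhR _) => u v w; nra.
move: e1 e2; rewrite /greenop.
move: (int0 (fun t => h t * gg t) L) (int0 (fun t => h t * gg t) x).
move: (int0 (fun t => h t * S t) x) (int0 (fun t => h t * Sr t) x).
move: (int0 (fun t => h t * Sr t) L) (Sr x) (S x) => a b c d e f g e1 e2; lra.
Qed.

End Positive.

End LinearProblem.

(** * The linear nonlocal fourth-order problem *)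

Section NonlocalLinear.
Variable R : realType.
Local Notation mu := (@lebesgue_measure R).
Variables (L m N : R).
Hypotheses (L0 : 0 < L) (m0 : 0 < m) (N0 : 0 < N).

Local Notation e := (torsion L).
Local Notation psi := (psi L m).
Local Notation gg := (gg L m).
Local Notation s0 := (sinhR (m * L)).
Local Notation greenop := (greenop L m).
Local Notation J := (int0 gg L).

Let L0' : 0 <= L. Proof. exact: ltW. Qed.
Let s0_gt0 : 0 < s0. Proof. by rewrite sinhR_gt0 // mulr_gt0. Qed.
Let L00 : 0 <= (0 : R) <= L. Proof. by rewrite lexx. Qed.
Let LL : 0 <= L <= L. Proof. by rewrite lexx L0'. Qed.

Definition lin_sol (h : R -> R) (d : nat -> R -> R) : Prop :=
  W41 L d /\ bc L d /\
  {ae mu, forall x, x \in `]0, L[ ->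
     d 4%N x - m * m * d 2%N x + N * int0 (d 0%N) L = h x}.

Lemma W41_AC (d : nat -> R -> R) k : W41 L d -> (k < 4)%N -> AC L (d k) (d k.+1).
Proof.
by move=> [h1 h2] k4; split; [exact/h1/ltnW|exact: h1|exact: h2].
Qed.

Lemma int0_eq0_AC (F f : R -> R) : AC L F f -> F 0 = 0 -> F L = 0 -> int0 f L = 0.
Proof.
move=> hF F0 FL; have := AC_sub hF L00 LL.
by rewrite F0 FL int0_0 !subr0.
Qed.

Lemma J_ge0 : 0 <= J.
Proof.
have [ig _ _] := AC_gg L0 m0.
rewrite -(int0_0 gg); apply: (int0_nd (lexx _) L0' (lexx _) ig).
by apply: aeW => t /andP[t0 tL]; apply: gg_ge0; rewrite // in_itv /= !ltW.
Qed.

Let NJ_gt0 : 0 < 1 + N * J.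
Proof. by have := J_ge0; have := N0; move: J => j; nra. Qed.

Section Representation.
Variables (h : R -> R) (d : nat -> R -> R).
Hypotheses (ih : Ig L h) (hd : lin_sol h d).

Let I := int0 (d 0%N) L.
Let q t := h t - N * I.

Let iq : Ig L q. Proof. by apply: IgB => //; exact: Ig_cst. Qed.
Let hdk k (k4 : (k < 4)%N) : AC L (d k) (d k.+1).
Proof. by have [hW _] := hd; exact: W41_AC. Qed.

Let eqq : {ae mu, forall x, x \in `]0, L[ ->
  m * m * - d 2%N x - - d 4%N x = q x}.
Proof.
have [_ [_ eq]] := hd; apply: (ae_imp eq) => t ht /ht; rewrite -/I /q => <-; ring.
Qed.

(* Pairing [y] with [e] gives [int y = int e v] for [v = - y''], and pairing
   [v] with [gg] gives [int e v = int q gg]. *)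
Lemma lin_sol_int : I * (1 + N * J) = int0 (fun t => h t * gg t) L.
Proof.
have [hW [[y0 [yL [y20 y2L]]] _]] := hd.
have b1 t : t \in `[0, L] -> `|(fun=> -1 : R) t| <= 1 by rewrite normrN1.
have hA := AC_Lagrange L0' (hdk (isT : (0 < 4)%N)) (hdk (isT : (1 < 4)%N))
  (AC_torsion L0) (AC_dtorsion L0) b1.
have hB := AC_Lagrange L0' (ACN (hdk (isT : (2 < 4)%N)))
  (ACN (hdk (isT : (3 < 4)%N))) (AC_gg L0 m0) (AC_gg1 L0 m0)
  (AC_bounded (ACB (ACZ (m * m) (AC_gg L0 m0)) (AC_torsion L0))).
have iy : Ig L (d 0%N) by have [] := hdk (isT : (0 < 4)%N).
have ihg := IgM_AC ih (AC_gg L0 m0).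
have [ig _ _] := AC_gg L0 m0.
have iw : Ig L (fun t => d 0%N t - (h t * gg t - N * I * gg t)).
  by apply: IgB => //; apply: IgB => //; exact: IgZ.
(* In the sum of the two Lagrange brackets the products of y'' with [e] cancel. The sum vanishes at
   0 and L, so its derivative integrates to I - int h gg + N I J = 0. *)
have hAB : AC L (fun t => (d 1%N t * e t - d 0%N t * (L / 2 - t)) +
    (- d 3%N t * gg t - - d 2%N t * gg1 L m t))
    (fun t => d 0%N t - (h t * gg t - N * I * gg t)).
  apply: AC_ae iw _ (ACD hA hB).
  apply: (ae_imp eqq) => t ht /ht; rewrite /q => E.
  by rewrite -mulrBl -E; ring.
have := int0_eq0_AC hAB.
rewrite y0 yL y20 y2L torsion0 torsionL gg0 (ggL L0 m0) => H.
have {H} : int0 (fun t => d 0%N t - (h t * gg t - N * I * gg t)) L = 0.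
  by apply: H; ring.
rewrite (int0B (lexx L) iy (IgB ihg (IgZ _ ig))).
rewrite (int0B (lexx L) ihg (IgZ _ ig)) (int0Z _ (lexx L) ig) -/I.
by move: (int0 _ _) (int0 _ _) => a b; lra.
Qed.

(** This is the Green representation of - y'' with source h - N I; by [psi_green], the constant N I
    contributes a multiple of [psi]. *)
Lemma lin_sol_green x : x \in `[0, L] ->
  m * s0 * - d 2%N x = greenop h x - N * I * (m * s0 * psi x).
Proof.
move=> xL; have [hW [[y0 [yL [y20 y2L]]] _]] := hd.
have z0 : - d 2%N 0 = 0 by rewrite y20 oppr0.
have zL : - d 2%N L = 0 by rewrite y2L oppr0.
have := green_repr L0 (ACN (hdk (isT : (2 < 4)%N))) (ACN (hdk (isT : (3 < 4)%N)))
  z0 zL iq eqq xL.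
move=> ->; rewrite (psi_green L0 m0 xL) /greenop.
move: xL; rewrite in_itv /= => /andP[x0 xL].
have iS := IgM_AC ih (AC_sinh m L0); have iSr := IgM_AC ih (AC_sinhr m L0).
have i1S := IgM_AC (Ig_cst L 1) (AC_sinh m L0).
have i1Sr := IgM_AC (Ig_cst L 1) (AC_sinhr m L0).
have E1 z : z <= L -> int0 (fun t => q t * sinhR (m * t)) z =
   int0 (fun t => h t * sinhR (m * t)) z - N * I * int0 (fun t => 1 * sinhR (m * t)) z.
  move=> zL'; rewrite -(int0Z _ zL' i1S) -(int0B zL' iS (IgZ _ i1S)).
  by apply: int0_eq => t _; rewrite /q; ring.
have E2 z : z <= L -> int0 (fun t => q t * sinhR (m * (L - t))) z =
   int0 (fun t => h t * sinhR (m * (L - t))) z -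
   N * I * int0 (fun t => 1 * sinhR (m * (L - t))) z.
  move=> zL'; rewrite -(int0Z _ zL' i1Sr) -(int0B zL' iSr (IgZ _ i1Sr)).
  by apply: int0_eq => t _; rewrite /q; ring.
rewrite E1 // !E2 // /=.
move: (int0 (fun t => h t * sinhR (m * t)) x).
move: (int0 (fun t => 1 * sinhR (m * t)) x).
move: (int0 (fun t => h t * sinhR (m * (L - t))) x).
move: (int0 (fun t => 1 * sinhR (m * (L - t))) x).
move: (int0 (fun t => h t * sinhR (m * (L - t))) L).
move: (int0 (fun t => 1 * sinhR (m * (L - t))) L).
by move: (sinhR _) (sinhR _) I => s r i a b c a1 f g; ring.
Qed.

End Representation.

Lemma lin_sol_exists (h : R -> R) : Ig L h -> exists d, lin_sol h d.
Proof.
(* The mean [I] is prescribed by [lin_sol_int]; solving with the source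
   [h - N I] then produces a solution whose mean is indeed [I]. *)
move=> ih.
have [I hI] : exists I, I * (1 + N * J) = int0 (fun t => h t * gg t) L.
  by exists (int0 (fun t => h t * gg t) L / (1 + N * J)); rewrite divfK ?gt_eqF.
have iq : Ig L (fun t => h t - N * I) by apply: IgB => //; exact: Ig_cst.
have [v [v1 [hv hv1 v0 vL]]] := dirichlet_exists L0 m0 iq.
have [iv _ _] := hv.
have iV : Ig L (int0 v).
  have [+ _ _] := AC_int0 0 L0' iv.
  by apply: Ig_eq => t _; rewrite add0r.
(* The slope y'(0) = A is the one that gives y(L) = 0 when y'' = - v and y(0) = 0. *)
pose A := int0 (int0 v) L / L.
pose y1 t := A - int0 v t.
have hy1 : AC L y1 (fun t => - v t).
  apply: AC_eq (ACB (AC_cst A L0') (AC_int0 0 L0' iv)) => // t _.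
    by rewrite add0r.
  by rewrite sub0r.
have [iy1 _ _] := hy1.
have hy := AC_int0 0 L0' iy1.
pose d k := match k with 0%N => (fun t => 0 + int0 y1 t) | 1%N => y1
  | 2%N => (fun t => - v t) | 3%N => (fun t => - v1 t)
  | _ => (fun t => - (m * m * v t - (h t - N * I))) end.
have hW : W41 L d.
  have [a0 a1 a2] := hy; have [b0 b1 b2] := hy1.
  have [c0 c1 c2] := ACN hv; have [e0 e1 e2] := ACN hv1.
  by split; case=> [|[|[|[|[|]]]]].
have hbc : bc L d.
  rewrite /bc /d int0_0 v0 vL oppr0 !add0r; split=> //; split=> //.
  rewrite (int0B (lexx L) (Ig_cst _ _) iV) int0_cst // /A divfK ?gt_eqF //.
  by rewrite subrr.
(* [h'] is the source that [d] has with its own mean I'. Then [lin_sol_int] reads (I' - I) (1 + N J)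
   = N (I' - I) J, which forces I' = I. *)
pose h' t := h t + N * (int0 (d 0%N) L - I).
have ih' : Ig L h' by apply: IgD => //; exact: Ig_cst.
have hl : lin_sol h' d.
  by split=> //; split=> //; apply: aeW => t _; rewrite /h' /=; ring.
have := lin_sol_int ih' hl.
have [ig _ _] := AC_gg L0 m0; have ihg := IgM_AC ih (AC_gg L0 m0).
have -> : int0 (fun t => h' t * gg t) L =
    I * (1 + N * J) + N * (int0 (d 0%N) L - I) * J.
  rewrite hI -(int0Z _ (lexx L) ig).
  rewrite -(int0D (lexx L) ihg (IgZ _ ig)).
  by apply: int0_eq => t _; rewrite /h'; ring.
move=> HI; have {}HI : int0 (d 0%N) L = I.
  by move: HI; move: (int0 (d 0%N) L) J => a c; lra.
exists d; case: hl => [_ [_ hl]]; split=> //; split=> //.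
by apply: (ae_imp hl) => t /[apply] ->; rewrite /h' HI subrr mulr0 addr0.
Qed.

Lemma lin_solB h h' d d' : lin_sol h d -> lin_sol h' d' ->
  lin_sol (fun t => h t - h' t) (fun k t => d k t - d' k t).
Proof.
move=> [[i1 hd1] [[a1 [a2 [a3 a4]]] e1]] [[i2 hd2] [[b1 [b2 [b3 b4]]] e2]].
split.
  split=> k k4; first by apply: IgB; [exact: i1|exact: i2].
  have := ACB (@W41_AC d k (conj i1 hd1) k4) (@W41_AC d' k (conj i2 hd2) k4).
  by case.
split; first by rewrite /bc a1 a2 a3 a4 b1 b2 b3 b4 subrr.
apply: (ae_imp2 e1 e2) => t h1 h2 tL; rewrite -(h1 tL) -(h2 tL).
by rewrite (int0B (lexx L) (i1 0%N isT) (i2 0%N isT)); ring.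
Qed.

Lemma lin_sol_concave_ge0 h d : lin_sol h d ->
  (forall x, x \in `[0, L] -> d 2%N x <= 0) ->
  forall x, x \in `[0, L] -> 0 <= d 0%N x.
Proof.
move=> [hW [[y0 [yL _]] _]] y2le.
apply: (concave_ge0 (W41_AC hW (isT : (0 < 4)%N)) (W41_AC hW (isT : (1 < 4)%N)) y0 yL).
apply: aeW => t /andP[t0 tL]; apply: y2le.
by rewrite in_itv /= !ltW.
Qed.

(* This is what the condition on [sigma] amounts to, see [kap_sub_J]. *)
Hypothesis hkap : N * kap L m <= 1 + N * J.

(** After multiplication by 1 + N J, the nonlocal term of [lin_sol_green] becomes N m s0 psi(x) int
    h gg. This is at most N kap greenop h x by [greenop_lower], hence at most (1 + N J) greenop h x
    by [hkap]. *)
Lemma lin_sol_le0 h d : Ig L h -> lin_sol h d ->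
  {ae mu, forall x, x \in `]0, L[ -> 0 <= h x} ->
  forall x, x \in `[0, L] -> d 2%N x <= 0.
Proof.
move=> ih hd h0 x xL.
have ms : 0 < m * s0 by rewrite mulr_gt0.
rewrite -oppr_ge0 -(pmulr_rge0 _ ms) (lin_sol_green ih hd xL) subr_ge0.
rewrite -(ler_pM2l NJ_gt0).
apply: le_trans (_ : N * kap L m * greenop h x <= _); last first.
  by apply: ler_wpM2r hkap; exact: greenop_ge0.
rewrite -mulrA; have := greenop_lower L0 m0 ih h0 xL.
rewrite -(lin_sol_int ih hd) -(ler_pM2l N0).
move: (m * s0 * psi x) (int0 (d 0%N) L) (greenop h x) J => a b c j.
have -> : (1 + N * j) * (N * (b * a)) = N * (a * (b * (1 + N * j))) by ring.
by rewrite [in X in X -> _](mulrA N (kap L m)).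
Qed.

Lemma lin_sol_le h h' d d' : Ig L h -> Ig L h' -> lin_sol h d -> lin_sol h' d' ->
  {ae mu, forall x, x \in `]0, L[ -> h x <= h' x} ->
  forall x, x \in `[0, L] -> d 0%N x <= d' 0%N x /\ d' 2%N x <= d 2%N x.
Proof.
move=> ih ih' hd hd' hh x xL.
have hB := lin_solB hd' hd.
have hp : forall x, x \in `[0, L] -> d' 2%N x - d 2%N x <= 0.
  apply: (lin_sol_le0 (IgB ih' ih) hB).
  by apply: (ae_imp hh) => t /[apply]; rewrite subr_ge0.
split; last by rewrite -subr_le0; exact: hp.
by rewrite -subr_ge0; exact: (lin_sol_concave_ge0 hB hp).
Qed.

Lemma greenop_upper h x : Ig L h -> x \in `[0, L] ->
  {ae mu, forall x, x \in `]0, L[ -> 0 <= h x} ->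
  greenop h x <= s0 * s0 * int0 h L.
Proof.
move=> ih hx h0; have := hx; rewrite in_itv /= => /andP[x0 xL].
(* Nonnegativity of [psi] says that the two sinh terms have sum at most s0. *)
have S_le t : t \in `[0, L] -> 0 <= sinhR (m * t) <= s0 /\ 0 <= sinhR (m * (L - t)) <= s0.
  move=> tL; have := psi_ge0 L0 m0 tL; move: tL; rewrite in_itv /= => /andP[t0 tL].
  have mms : 0 < m * m * s0 by rewrite mulr_gt0 // mulr_gt0.
  rewrite -(pmulr_rge0 _ mms) (psi_sym_expr L0 m0) /=.
  have := sinh_ge0 m0 t0; have := sinhr_ge0 m0 tL => /=.
  by move: (sinhR _) (sinhR _) (sinhR _) => a b c; lra.
have iS := IgM_AC ih (AC_sinh m L0); have iSr := IgM_AC ih (AC_sinhr m L0).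
have e1 : int0 (fun t => h t * sinhR (m * t)) x <= s0 * int0 h x.
  rewrite -(int0Z _ xL ih); have := int0_le (lexx _) x0 xL iS (IgZ s0 ih).
  rewrite !int0_0 !subr0; apply; apply: (ae_imp h0) => t ht.
  rewrite in_itv /= => /andP[t0 tx].
  have tL : t \in `[0, L] by rewrite in_itv /=; lra.
  rewrite mulrC; apply: ler_wpM2r; first by apply: ht; rewrite in_itv /=; lra.
  by have [/andP[]] := S_le t tL.
have e2 : int0 (fun t => h t * sinhR (m * (L - t))) L -
    int0 (fun t => h t * sinhR (m * (L - t))) x <= s0 * (int0 h L - int0 h x).
  rewrite mulrBr -(int0Z _ xL ih) -(int0Z _ (lexx L) ih).
  apply: (int0_le x0 xL (lexx _) iSr (IgZ s0 ih)); apply: (ae_imp h0) => t ht.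
  rewrite in_itv /= => /andP[t0 tx].
  have tL : t \in `[0, L] by rewrite in_itv /=; lra.
  rewrite mulrC; apply: ler_wpM2r; first by apply: ht; rewrite in_itv /=; lra.
  by have [_ /andP[]] := S_le t tL.
have ih0 z : 0 <= z -> z <= L -> 0 <= int0 h z.
  move=> z0 zL; rewrite -(int0_0 h); apply: (int0_nd (lexx _) z0 zL ih).
  apply: (ae_imp h0) => t ht; rewrite in_itv /= => /andP[t0 tz].
  by apply: ht; rewrite in_itv /= t0 (lt_le_trans tz zL).
have hx0 := ih0 x x0 xL.
have hxL : 0 <= int0 h L - int0 h x.
  rewrite subr_ge0; apply: (int0_nd x0 xL (lexx _) ih).
  apply: (ae_imp h0) => t ht; rewrite in_itv /= => /andP[t0 tz].
  by apply: ht; rewrite in_itv /= (le_lt_trans x0 t0) tz.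
have [/andP[p1 p2] /andP[p3 p4]] := S_le x hx.
have s0' := ltW s0_gt0.
have -> : s0 * s0 * int0 h L = s0 * (s0 * int0 h x) + s0 * (s0 * (int0 h L - int0 h x)).
  by ring.
rewrite /greenop; apply: lerD.
  apply: le_trans (ler_wpM2l p3 e1) _; apply: ler_wpM2r => //.
  exact: mulr_ge0.
apply: le_trans (ler_wpM2l p1 e2) _; apply: ler_wpM2r => //.
exact: mulr_ge0.
Qed.

Lemma lin_sol_norm : exists K, 0 <= K /\ forall h d, Ig L h -> lin_sol h d ->
  forall x, x \in `[0, L] ->
  `|d 2%N x| <= K * int0 (fun t => `|h t|) L /\
  `|d 0%N x| <= K * int0 (fun t => `|h t|) L.
Proof.
have K10 : 0 <= s0 / m by rewrite divr_ge0 // ltW.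
(* Up to the L^1 norm of h, s0 / m bounds - D'' for the solution [D] with source |h|, and s0 / m *
   (L * L) bounds [D]. The sum serves both estimates. *)
exists (s0 / m * (1 + L * L)); split.
  by rewrite mulr_ge0 // addr_ge0 // mulr_ge0.
move=> h d ih hd x xL.
have ia := Ig_norm ih; have iNa := IgN ia.
(* The solution [D] for [|h|] dominates both [d] and [- d]. *)
have [D hD] := lin_sol_exists ia.
set K := int0 (fun t => `|h t|) L.
have K0 : 0 <= K.
  rewrite -(int0_0 (fun t => `|h t|)); apply: (int0_nd (lexx _) L0' (lexx _) ia).
  exact: aeW.
have hND : lin_sol (fun t => - `|h t|) (fun k t => - D k t).
  have := lin_solB (lin_solB hD hD) hD.
  have Ek : (fun (k : nat) t => D k t - D k t - D k t) = (fun k t => - D k t).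
    by apply/funext => k; apply/funext => t; rewrite subrr sub0r.
  rewrite Ek; have -> // : (fun t => `|h t| - `|h t| - `|h t|) = (fun t => - `|h t|).
  by apply/funext => t; rewrite subrr sub0r.
have ae1 : {ae mu, forall t, t \in `]0, L[ -> h t <= `|h t|}.
  by apply: aeW => t _; exact: ler_norm.
have ae2 : {ae mu, forall t, t \in `]0, L[ -> - `|h t| <= h t}.
  by apply: aeW => t _; rewrite lerNl -normrN ler_norm.
have ae0 : {ae mu, forall t, t \in `]0, L[ -> 0 <= `|h t|} by exact: aeW.
have [u1 u2] := lin_sol_le ih ia hd hD ae1 xL.
have [l1 l2] := lin_sol_le iNa ih hND hd ae2 xL.
have D2 t : t \in `[0, L] -> - D 2%N t <= s0 / m * K.
  move=> tL; have ms : 0 < m * s0 by rewrite mulr_gt0.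
  rewrite -(ler_pM2l ms) (lin_sol_green ia hD tL).
  have Dpos := lin_sol_le0 ia hD ae0.
  have D0 := lin_sol_concave_ge0 hD Dpos.
  have ID : 0 <= int0 (D 0%N) L.
    have iD : Ig L (D 0%N) by have [[+ _] _] := hD; apply.
    rewrite -(int0_0 (D 0%N)); apply: (int0_nd (lexx _) L0' (lexx _) iD).
    by apply: aeW => s /andP[s1 s2]; apply: D0; rewrite in_itv /= !ltW.
  have G := greenop_upper ia tL ae0.
  apply: le_trans (_ : _ <= greenop (fun t => `|h t|) t) _.
    rewrite gerBl; apply: mulr_ge0; first by apply: mulr_ge0 => //; exact: ltW.
    exact: (mulr_ge0 (ltW ms) (psi_ge0 L0 m0 tL)).
  apply: (le_trans G); rewrite -/K.
  have -> // : m * s0 * (s0 / m * K) = s0 * s0 * K by field; rewrite gt_eqF.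
(* By [D2] and e'' = -1, the difference of the two sides is concave, and it vanishes at both
   ends. *)
have De : D 0%N x <= s0 / m * K * e x.
  rewrite -subr_ge0.
  have [hW [[y0 [yL _]] _]] := hD.
  have h1 := ACB (ACZ (s0 / m * K) (AC_torsion L0)) (W41_AC hW (isT : (0 < 4)%N)).
  have h2 := ACB (ACZ (s0 / m * K) (AC_dtorsion L0)) (W41_AC hW (isT : (1 < 4)%N)).
  apply: (concave_ge0 h1 h2) => //.
  - by rewrite torsion0 y0; ring.
  - by rewrite torsionL yL; ring.
  - apply: aeW => t /andP[t0 tL].
    have tI : t \in `[0, L] by rewrite in_itv /= !ltW.
    by have := D2 t tI; lra.
have eL : e x <= L * L.
  move: xL; rewrite in_itv /= /torsion => /andP[x0 xL]; nra.
have KK : 0 <= s0 / m * K by rewrite mulr_ge0.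
have D2x := D2 x xL.
have E : s0 / m * (1 + L * L) * K = s0 / m * K + s0 / m * K * (L * L) by ring.
have KL : 0 <= s0 / m * K * (L * L) by rewrite mulr_ge0 // mulr_ge0.
have De' := le_trans De (ler_wpM2l KK eL).
rewrite E; split; rewrite ler_norml; apply/andP; split; lra.
Qed.

End NonlocalLinear.

(** * The condition on sigma *)

Section SigmaCondition.
Variable R : realType.
Variables (L m : R).
Hypotheses (L0 : 0 < L) (m0 : 0 < m).
Local Notation s0 := (sinhR (m * L)).
Local Notation c0 := (coshR (m * L)).

Lemma int0_torsion : int0 (torsion L) L = L ^+ 3 / 12.
Proof.
have dE (x : R) : is_derive x 1 (fun t : R => L / 4 * t ^+ 2 - t ^+ 3 / 6) (torsion L x).
  by apply: is_derive_eq; rewrite /torsion /GRing.scale /=; field.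
have de (x : R) : is_derive x 1 (torsion L) (L / 2 - x).
  by rewrite /torsion; apply: is_derive_eq; rewrite /GRing.scale /= ?mulr1; field.
have := AC_smooth L0 dE (continuous_is_derive de).
case=> _ _ /(_ L); rewrite in_itv /= lexx ltW // => /(_ isT).
rewrite expr0n /= expr0n /= mulr0 mul0r subrr add0r => <-; by field.
Qed.

(** Integrating gg'' = m^2 gg - torsion over [0, L] expresses the integral of [gg] by the end
    slopes. The numerator obtained is the denominator of [sigma] at m L. *)
Lemma kap_sub_J : kap L m - int0 (gg L m) L =
  (6 * (m * L) * c0 + 6 * (m * L) - 12 * s0 - (m * L) ^+ 3) / (12 * m ^+ 5).
Proof.
have m_neq0 : m != 0 by rewrite gt_eqF.
have s_gt0 : 0 < s0 by rewrite sinhR_gt0 // mulr_gt0.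
(* [k] is tanh(m L / 2). The relation k (c0 + 1) = s0 replaces cosh^2 - sinh^2 = 1 and leaves
   identities that [field] can check. *)
have [k kE] : exists k, k = (c0 - 1) / s0 by eexists.
have kc : k * c0 = s0 - k.
  rewrite -[s0 in RHS](mulfK (lt0r_neq0 s_gt0)).
  have -> : s0 * s0 = c0 * c0 - 1 by have := coshR2B (m * L); lra.
  by rewrite kE; move: (lt0r_neq0 s_gt0); move: s0 c0 => s c h; field.
have [[ig _ _] [ie _ _]] := (AC_gg L0 m0, AC_torsion L0).
have LL : 0 <= L <= L by rewrite lexx ltW.
have L00 : 0 <= (0 : R) <= L by rewrite lexx ltW.
have := AC_sub (AC_gg1 L0 m0) L00 LL.
rewrite int0_0 subr0 (int0B (lexx L) (IgZ _ ig) ie) (int0Z _ (lexx L) ig) int0_torsion.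
have -> : gg1 L m L - gg1 L m 0 = (2 * k / m - L) / (m * m).
  rewrite /gg1 /psi1 mulr0 coshR0 sinhR0 -kE mulrA kc.
  by move: s0 => s; field.
have -> : kap L m = ((c0 - 1) * (L * m / 2) - s0 + 2 * k) / m ^+ 5.
  rewrite /kap /gam -kE; have -> : s0 = k * c0 + k by rewrite kc subrK.
  by move: c0 => c; field.
move: (int0 (gg L m) L) s0 c0 => J s c H.
have -> : J = ((2 * k / m - L) / (m * m) + L ^+ 3 / 12) / (m * m).
  rewrite H subrK mulrC mulKf //.
  by rewrite mulf_neq0.
by field.
Qed.

Lemma sigma_kap N : 0 < N ->
  N <= 4 * (m * m) / L ^+ 3 * sigma (m * L) ->
  N * kap L m <= 1 + N * int0 (gg L m) L.
Proof.
move=> N0 hN; rewrite -lerBlDr -mulrBr kap_sub_J.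
move: hN; rewrite /sigma.
set D := 6 * (m * L) * c0 + 6 * (m * L) - 12 * s0 - (m * L) ^+ 3.
have mL : 0 < m * L by rewrite mulr_gt0.
have m5 : 0 < 12 * m ^+ 5 by rewrite mulr_gt0 // exprn_gt0.
have -> : 4 * (m * m) / L ^+ 3 * (3 * (m * L) ^+ 3 / D) = 12 * m ^+ 5 / D.
  (* The inverse of [D] is generalized, as [D] is not yet known to be nonzero. *)
  by move: D => D; rewrite -[D^-1]mul1r; move: (1 / D) => E; field; rewrite gt_eqF.
move=> hN.
(* Positivity of [D] comes from the condition itself: for D <= 0, including D = 0 with inverse 0,
   the right side of [hN] would be nonpositive, against N > 0. *)
have D0 : 0 < D.
  rewrite ltNge; apply/negP => D0.
  have : 12 * m ^+ 5 / D <= 0 by rewrite pmulr_rle0 // invr_le0.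
  by move=> /(le_trans hN); rewrite leNgt N0.
by rewrite mulrA ler_pdivrMr // mul1r -ler_pdivlMr.
Qed.

End SigmaCondition.

(** * Monotone iteration *)

Section MonotoneIteration.
Variable R : realType.
Local Notation mu := (@lebesgue_measure R).
Variables (L m N b A B : R) (p hb : R -> R) (beta : nat -> R -> R).
Hypotheses (L0 : 0 < L) (m0 : 0 < m) (N0 : 0 < N) (b0 : 0 < b).
Hypothesis hkap : N * kap L m <= 1 + N * int0 (gg L m) L.
Hypothesis ip : Ig L p.
Hypothesis beta_int : int0 (beta 0%N) L = A.
Hypothesis beta_lb : forall x, x \in `[0, L] -> - B <= beta 2%N x.
Hypotheses (ihb : Ig L hb) (hbeta : lin_sol L m N hb beta).

Local Notation lin_sol := (lin_sol L m N).
Let L0' : 0 <= L. Proof. exact: ltW. Qed.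

(* The order of the cone [{u >= 0, u'' <= 0}]. *)
Definition ole (y z : nat -> R -> R) := forall x, x \in `[0, L] ->
  y 0%N x <= z 0%N x /\ z 2%N x <= y 2%N x.

(** These are the two components that [rhs] reads; their integrability makes [rhs y] an integrable
    source. *)
Definition adm (y : nat -> R -> R) := Ig L (y 0%N) /\ Ig L (y 2%N).

(* [A] and [B] stand for [2 lam L / pi], the integral of [beta], and
   [lam pi^2 / L^2], the maximum of [- beta'']. *)
Definition rhs (y : nat -> R -> R) x := p x + b * y 2%N x * int0 (y 0%N) L
  - b * A * y 2%N x + b * B * int0 (y 0%N) L.

Lemma lin_sol_adm h d : lin_sol h d -> adm d.
Proof. by move=> [[+ _] _] => h1; split; exact: h1. Qed.

Lemma Ig_rhs y : adm y -> Ig L (rhs y).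
Proof.
move=> [_ i2]; apply: IgD; last exact: Ig_cst.
apply: IgB; last exact: IgZ.
apply: IgD => //.
by apply: Ig_eq (IgZ (b * int0 (y 0%N) L) i2) => t _; ring.
Qed.

Lemma int0_le_itv (f g : R -> R) : Ig L f -> Ig L g ->
  (forall x, x \in `[0, L] -> f x <= g x) -> int0 f L <= int0 g L.
Proof.
move=> hf hg fg; have := int0_le (lexx _) L0' (lexx _) hf hg.
rewrite !int0_0 !subr0; apply; apply: aeW => t /andP[t0 tL].
by apply: fg; rewrite in_itv /= !ltW.
Qed.

(** With i <= j the integrals and u >= u' the second derivatives of y and z, the difference is b (u
    - u') (A - i) + b (j - i) (B + u'). The bound by [beta] makes A - i and B + u' nonnegative. *)
Lemma rhs_le y z : adm y -> adm z -> ole y z -> ole z beta ->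
  forall x, x \in `[0, L] -> rhs y x <= rhs z x.
Proof.
move=> ay az yz zb x xL.
have Iyz : int0 (y 0%N) L <= int0 (z 0%N) L.
  by apply: int0_le_itv => [||t tL]; [case: ay|case: az|case: (yz t tL)].
have IzA : int0 (z 0%N) L <= A.
  rewrite -beta_int; apply: int0_le_itv => [||t tL]; [by case: az| |by case: (zb t tL)].
  by have [] := lin_sol_adm hbeta.
have [_ v] := yz x xL; have [_ w] := zb x xL; have lb := beta_lb xL.
rewrite /rhs; move: Iyz IzA v w lb.
move: (int0 (y 0%N) L) (int0 (z 0%N) L) (y 2%N x) (z 2%N x) (beta 2%N x) (p x).
move=> i j u u' w q ij jA uu' wu' Bw.
have h1 : 0 <= b * ((u - u') * (A - i)).
  by apply: mulr_ge0; [exact: ltW|apply: mulr_ge0; lra].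
have h2 : 0 <= b * ((j - i) * (B + u')).
  by apply: mulr_ge0; [exact: ltW|apply: mulr_ge0; lra].
rewrite -subr_ge0.
have -> // : q + b * u' * j - b * A * u' + b * B * j -
   (q + b * u * i - b * A * u + b * B * i) =
   b * ((u - u') * (A - i)) + b * ((j - i) * (B + u')) by ring.
exact: addr_ge0.
Qed.

(** The sources satisfy rhs y <= rhs u <= hu, so [lin_sol_le] applies. A separate source [hu] covers
    both the upper solution and exact solutions, for which hu = rhs u. *)
Lemma step_super y y' u hu : adm y -> lin_sol (rhs y) y' ->
  Ig L hu -> lin_sol hu u -> {ae mu, forall x, x \in `]0, L[ -> rhs u x <= hu x} ->
  ole u beta -> ole y u -> ole y' u.
Proof.
move=> ay hy' ihu hu' su ub yu x xL.
have au := lin_sol_adm hu'.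
apply: (lin_sol_le L0 m0 N0 hkap (Ig_rhs ay) ihu hy' hu' _ xL).
apply: (ae_imp su) => t st tL; apply: le_trans (st tL).
by apply: rhs_le => //; move: tL => /andP[t0 t1]; rewrite in_itv /= !ltW.
Qed.

Lemma step_sub y y' u hu : adm y -> lin_sol (rhs y) y' ->
  Ig L hu -> lin_sol hu u -> {ae mu, forall x, x \in `]0, L[ -> hu x <= rhs u x} ->
  ole y beta -> ole u y -> ole u y'.
Proof.
move=> ay hy' ihu hu' su ub yu x xL.
have au := lin_sol_adm hu'.
apply: (lin_sol_le L0 m0 N0 hkap ihu (Ig_rhs ay) hu' hy' _ xL).
apply: (ae_imp su) => t st tL; apply: (le_trans (st tL)).
by apply: rhs_le => //; move: tL => /andP[t0 t1]; rewrite in_itv /= !ltW.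
Qed.

Lemma step_mono y y' z z' : adm y -> adm z ->
  lin_sol (rhs y) y' -> lin_sol (rhs z) z' -> ole z beta -> ole y z -> ole y' z'.
Proof.
move=> ay az hy' hz' zb yz x xL.
apply: (lin_sol_le L0 m0 N0 hkap (Ig_rhs ay) (Ig_rhs az) hy' hz' _ xL).
apply: aeW => t tL.
by apply: rhs_le => //; move: tL => /andP[t0 t1]; rewrite in_itv /= !ltW.
Qed.

Lemma mono_is_cvg (u : nat -> R) (lo hi : R) : (forall n, lo <= u n <= hi) ->
  (forall n, u n <= u n.+1) \/ (forall n, u n.+1 <= u n) -> cvgn u.
Proof.
move=> bu [ui|ud].
  apply: nondecreasing_is_cvgn; first exact/nondecreasing_seqP.
  by exists hi => _ [n _ <-]; have /andP[] := bu n.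
apply: nonincreasing_is_cvgn; first exact/nonincreasing_seqP.
by exists lo => _ [n _ <-]; have /andP[] := bu n.
Qed.

(** * Limit of a monotone sequence of iterates between 0 and [beta] *)

Section Limit.
Variable Y : nat -> nat -> R -> R.
Hypotheses (aY0 : adm (Y 0%N)) (sY : forall n, lin_sol (rhs (Y n)) (Y n.+1)).
Hypothesis Y_ge0 : forall n, ole (@zero_d R) (Y n).
Hypothesis Y_le : forall n, ole (Y n) beta.
Hypothesis Y_mono : (forall n, ole (Y n) (Y n.+1)) \/ (forall n, ole (Y n.+1) (Y n)).

Let aY n : adm (Y n).
Proof. by case: n => // n; exact: lin_sol_adm (sY n). Qed.

Let I n := int0 (Y n 0%N) L.
Let I_bnd n : 0 <= I n <= A.
Proof.
have [i0 _] := aY n; have [ib _] := lin_sol_adm hbeta.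
rewrite -beta_int; apply/andP; split.
  have := @int0_le_itv (fun=> 0) (Y n 0%N) (Ig_cst _ _) i0.
  by rewrite int0_cst // mul0r; apply=> t tL; have [] := Y_ge0 n tL.
by apply: int0_le_itv => // t tL; have [] := Y_le n tL.
Qed.

Let v_bnd n x : x \in `[0, L] -> - B <= Y n 2%N x <= 0.
Proof.
move=> xL; have [_ h1] := Y_ge0 n xL; have [_ h2] := Y_le n xL.
by rewrite h1 andbT (le_trans (beta_lb xL)).
Qed.

Let cvgI : cvgn I.
Proof.
apply: (mono_is_cvg I_bnd); case: Y_mono => h; [left|right] => n.
- apply: int0_le_itv => [||t tL]; [by have [] := aY n|by have [] := aY n.+1|].
  by have [] := h n t tL.
- apply: int0_le_itv => [||t tL]; [by have [] := aY n.+1|by have [] := aY n|].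
  by have [] := h n t tL.
Qed.

Let cvgv x : x \in `[0, L] -> cvgn (fun n => Y n 2%N x).
Proof.
move=> xL; apply: (mono_is_cvg (fun n => v_bnd n xL)).
by case: Y_mono => h; [right|left] => n; have [] := h n x xL.
Qed.

Let Iinf := limn I.
Let vinf x := limn (fun n => Y n 2%N x).
Let hinf x := p x + b * vinf x * Iinf - b * A * vinf x + b * B * Iinf.

Let rhs_cvg x : x \in `[0, L] -> rhs (Y n) x @[n --> \oo] --> hinf x.
Proof.
move=> xL; apply: cvgD; last by apply: cvgM; [exact: cvg_cst|exact: cvgI].
apply: cvgB; last by apply: cvgM; [exact: cvg_cst|exact: cvgv].
apply: cvgD; first exact: cvg_cst.
apply: cvgM; last exact: cvgI.
by apply: cvgM; [exact: cvg_cst|exact: cvgv].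
Qed.

Let rhs_bnd n x : x \in `[0, L] -> `|rhs (Y n) x| <= `|p x| + b * (B * A).
Proof.
move=> xL; have /andP[i0 iA] := I_bnd n; have /andP[vB v0] := v_bnd n xL.
rewrite /rhs -/(I n).
(* For v in [-B, 0] and i in [0, A], - v (A - i) + B i is nonnegative, and (B + v) (A - i) >= 0
   bounds it by B A. *)
have -> : p x + b * Y n 2%N x * I n - b * A * Y n 2%N x + b * B * I n =
  p x + b * (- Y n 2%N x * (A - I n) + B * I n) by ring.
apply: (le_trans (ler_normD _ _)); rewrite lerD2l.
move: (I n) (Y n 2%N x) i0 iA vB v0 => i v i0 iA vB v0.
have h1 : 0 <= - v * (A - i) by rewrite mulr_ge0 ?subr_ge0 ?oppr_ge0.
have h2 : 0 <= B * i by rewrite mulr_ge0 //; lra.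
have h3 : 0 <= (B + v) * (A - i) by rewrite mulr_ge0 ?subr_ge0 //; lra.
rewrite ger0_norm; last by apply: mulr_ge0; [exact: ltW|exact: addr_ge0].
by apply: ler_wpM2l; [exact: ltW|lra].
Qed.

Let L1_cvg : Ig L hinf /\ forall e : R, 0 < e -> exists n0 : nat,
  forall n, (n0 <= n)%N -> int0 (fun t => `|rhs (Y n) t - hinf t|) L < e.
Proof.
have mh : measurable_fun `[0, L] hinf.
  apply: (measurable_fun_cvg (h := fun n => rhs (Y n))).
    by move=> n; exact: Ig_measurable (Ig_rhs (aY n)).
  by move=> x xL; exact: rhs_cvg.
have ig : Ig L (fun x => `|p x| + b * (B * A)).
  by apply: IgD; [exact: Ig_norm|exact: Ig_cst].
have [|||||ih cv _] := @dominated_convergence _ _ R mu `[0, L]%classic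
  (measurable_itv _) (fun n x => (rhs (Y n) x)%:E) (EFin \o hinf)
  (EFin \o (fun x => `|p x| + b * (B * A))).
- by move=> n; exact: measurable_int (Ig_rhs (aY n)).
- exact/measurable_EFinP.
- by apply: aeW => x xL; apply: cvg_EFin; [exact: nearW|exact: rhs_cvg].
- exact: ig.
- by apply: aeW => x n xL; rewrite /= lee_fin; exact: rhs_bnd.
split=> // e e0.
have cv2 : int0 (fun t => `|rhs (Y n) t - hinf t|) L @[n --> \oo] --> (0 : R).
  by move/fine_cvgP : cv => [].
have [n0 _ H] := (cvgrPdist_lt _ _).1 cv2 e e0.
exists n0 => n nn; have := H n nn.
by rewrite /= sub0r normrN => /(le_lt_trans (ler_norm _)).
Qed.

(* The sources converge in [L^1] by dominated convergence, and the [L^1] bound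
   on solutions turns this into uniform convergence. *)
Lemma iteration_limit : exists d, lin_sol (rhs d) d /\
  forall e : R, 0 < e -> exists n0 : nat, forall n, (n0 <= n)%N ->
  forall x, x \in `[0, L] ->
    `|Y n 0%N x - d 0%N x| < e /\ `|Y n 2%N x - d 2%N x| < e.
Proof.
have [ih L1] := L1_cvg.
have [d hd] := lin_sol_exists L0 m0 N0 ih.
have [K [K0 HK]] := lin_sol_norm L0 m0 N0 hkap.
have unif (e : R) : 0 < e -> exists n0 : nat, forall n, (n0 <= n)%N ->
    forall x, x \in `[0, L] ->
    `|Y n 0%N x - d 0%N x| < e /\ `|Y n 2%N x - d 2%N x| < e.
  move=> e0; have K1 : 0 < K + 1 by lra.
  have [n0 Hn0] := L1 (e / (K + 1)) (divr_gt0 e0 K1).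
  (* The shift by one reflects that [Y n.+1] is controlled by the source built from [Y n]. *)
  exists n0.+1 => -[//|n] nn x xL.
  have [h2 h0] := HK _ _ (IgB (Ig_rhs (aY n)) ih) (lin_solB (sY n) hd) x xL.
  have := Hn0 n nn; rewrite ltr_pdivlMr // => h3.
  have i0 : 0 <= int0 (fun t => `|rhs (Y n) t - hinf t|) L.
    by apply: Rintegral_ge0.
  by split; [apply: (le_lt_trans h0)|apply: (le_lt_trans h2)];
     move: h3 i0; move: (int0 _ _) => z; nra.
exists d; split=> //.
(* Uniform convergence identifies [vinf] with d'' and [Iinf] with the integral of d, so that [hinf]
   is [rhs d] on [0, L]. *)
have dv x : x \in `[0, L] -> vinf x = d 2%N x.
  move=> xL; apply/cvg_lim => //; apply/cvgrPdist_lt => e e0.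
  have [n0 H] := unif e e0; exists n0 => // n nn /=.
  by rewrite distrC; have [] := H n nn x xL.
have [id0 id2] := lin_sol_adm hd.
have dI : Iinf = int0 (d 0%N) L.
  apply/cvg_lim => //; apply/cvgrPdist_lt => e e0.
  have L1' : 0 < L + 1 by exact: addr_gt0 L0 ltr01.
  have eL : 0 < e / (L + 1) by rewrite divr_gt0.
  have [n0 H] := unif _ eL; exists n0 => // n nn /=; rewrite distrC.
  have [iYn _] := aY n.
  rewrite /I -(int0B (lexx L) iYn id0).
  have := int0_norm_le (lexx _) L0' (lexx _) (IgB iYn id0) (Ig_cst L (e / (L + 1))).
  rewrite !int0_0 !subr0 int0_cst // => h; apply: (le_lt_trans (h _)).
    apply: aeW => t /andP[t0 tL]; apply: ltW.
    have tI : t \in `[0, L] by rewrite in_itv /= !ltW.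
    by have [] := H n nn t tI.
  by rewrite mulrAC ltr_pdivrMr // ltr_pM2l // ltrDl.
case: hd => [hW [hbc eq]]; split=> //; split=> //.
apply: (ae_imp eq) => t ht tL; rewrite (ht tL) /hinf /rhs -dI dv //.
by move: tL => /andP[t0 t1]; rewrite in_itv /= !ltW.
Qed.

End Limit.

Lemma ole_refl y : ole y y. Proof. by []. Qed.

Lemma le_of_close (u v : R) : (forall e : R, 0 < e -> exists2 w, `|w - u| < e & w <= v) ->
  u <= v.
Proof.
move=> h; apply/ler_addgt0Pr => e /h[w]; rewrite ltr_norml => /andP[h1 _] h2; lra.
Qed.

Section OrderLimit.
Variables (Y : nat -> nat -> R -> R) (d u : nat -> R -> R).
Hypothesis Yd : forall e : R, 0 < e -> exists n0 : nat, forall n, (n0 <= n)%N ->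
  forall x, x \in `[0, L] ->
    `|Y n 0%N x - d 0%N x| < e /\ `|Y n 2%N x - d 2%N x| < e.

Lemma ole_limr : (forall n, ole (Y n) u) -> ole d u.
Proof.
move=> Yu x xL; split; first apply: le_of_close => e e0.
  have [n0 /(_ n0 (leqnn _) x xL)[h _]] := Yd e0.
  by exists (Y n0 0%N x) => //; have [] := Yu n0 x xL.
rewrite -lerN2; apply: le_of_close => e e0.
have [n0 /(_ n0 (leqnn _) x xL)[_ h]] := Yd e0.
exists (- Y n0 2%N x); first by rewrite -opprD normrN.
by rewrite lerN2; have [] := Yu n0 x xL.
Qed.

Lemma ole_liml : (forall n, ole u (Y n)) -> ole u d.
Proof.
move=> Yu x xL; split; last apply: le_of_close => e e0.
  rewrite -lerN2; apply: le_of_close => e e0.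
  have [n0 /(_ n0 (leqnn _) x xL)[h _]] := Yd e0.
  exists (- Y n0 0%N x); first by rewrite -opprD normrN.
  by rewrite lerN2; have [] := Yu n0 x xL.
have [n0 /(_ n0 (leqnn _) x xL)[_ h]] := Yd e0.
by exists (Y n0 2%N x) => //; have [] := Yu n0 x xL.
Qed.

End OrderLimit.

Lemma exists_iteration y0 : adm y0 -> exists Y : nat -> nat -> R -> R,
  Y 0%N = y0 /\ forall n, lin_sol (rhs (Y n)) (Y n.+1).
Proof.
move=> ay0.
have /choice[f hf] : forall y, exists y', adm y -> lin_sol (rhs y) y'.
  (* An inadmissible [y] gets itself as a dummy successor; iterates of [y0] never meet this case. *)
  move=> y; case: (pselect (adm y)) => [ay|nay]; last by exists y.
  by have [y' hy'] := lin_sol_exists L0 m0 N0 (Ig_rhs ay); exists y'.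
exists (fun n => iter n f y0); split=> // n.
have ay k : adm (iter k f y0).
  by elim: k => // k IH; exact: lin_sol_adm (hf _ IH).
exact: hf.
Qed.

Hypothesis p_ge0 : {ae mu, forall x, x \in `]0, L[ -> 0 <= p x}.
Hypothesis beta_super : {ae mu, forall x, x \in `]0, L[ -> rhs beta x <= hb x}.
Hypothesis beta_ge0 : ole (@zero_d R) beta.

Let zero_sol : lin_sol (fun=> 0) (@zero_d R).
Proof.
have i0 : Ig L (fun=> 0 : R) by exact: Ig_cst.
split.
  split=> [k _|k _ x /andP[x0 _]]; first exact: i0.
  by rewrite /zero_d int0_cst // mul0r addr0.
by split=> //; apply: aeW => x _; rewrite /zero_d int0_cst //; ring.
Qed.

Let zero_sub : {ae mu, forall x, x \in `]0, L[ -> 0 <= rhs (@zero_d R) x}.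
Proof.
apply: (ae_imp p_ge0) => t /[apply] p0; rewrite /rhs /zero_d int0_cst //.
by rewrite !(mul0r, mulr0) subr0 !addr0.
Qed.

(** * Iterates started at the two ends of the order interval *)

Section Sequences.
Variable Y : nat -> nat -> R -> R.
Hypotheses (aY0 : adm (Y 0%N)) (sY : forall n, lin_sol (rhs (Y n)) (Y n.+1)).

Let aY n : adm (Y n).
Proof. by case: n => // n; exact: lin_sol_adm (sY n). Qed.

(** Serves for u = beta with source [hb], and for any solution u with source [rhs u]. *)
Let stay_le u hu : Ig L hu -> lin_sol hu u ->
  {ae mu, forall x, x \in `]0, L[ -> rhs u x <= hu x} -> ole u beta ->
  ole (Y 0%N) u -> forall n, ole (Y n) u.
Proof.
move=> ihu lu su ub Y0u; elim=> // n IH.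
exact: (step_super (aY n) (sY n) ihu lu su ub IH).
Qed.

Let stay_ge u hu : Ig L hu -> lin_sol hu u ->
  {ae mu, forall x, x \in `]0, L[ -> hu x <= rhs u x} ->
  (forall n, ole (Y n) beta) ->
  ole u (Y 0%N) -> forall n, ole u (Y n).
Proof.
move=> ihu lu su ub Y0u; elim=> // n IH.
exact: (step_sub (aY n) (sY n) ihu lu su (ub n) IH).
Qed.

(** All iterates stay below each solution u of the order interval, as 0 does, and this passes to the
    limit. Monotonicity starts from Y 0 = 0 <= Y 1 and propagates by [step_mono]. *)
Lemma minimal_limit :
  (forall x, x \in `[0, L] -> Y 0%N 0%N x = 0 /\ Y 0%N 2%N x = 0) ->
  exists d, [/\ lin_sol (rhs d) d, ole (@zero_d R) d, ole d beta,
    (forall u, lin_sol (rhs u) u -> ole (@zero_d R) u -> ole u beta -> ole d u) &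
    unif_cvg_on L (fun n => Y n 0%N) (d 0%N)].
Proof.
move=> Y0E.
have Y0l u : ole (@zero_d R) u -> ole (Y 0%N) u.
  by move=> h x xL; have [-> ->] := Y0E x xL; exact: h.
have Y0g : ole (@zero_d R) (Y 0%N).
  by move=> x xL; have [-> ->] := Y0E x xL; rewrite /zero_d.
have Yb := stay_le ihb hbeta beta_super (@ole_refl _) (Y0l _ beta_ge0).
have Y0 := stay_ge (Ig_cst L 0) zero_sol zero_sub Yb Y0g.
have Ym n : ole (Y n) (Y n.+1).
  elim: n => [|n IH]; first exact/Y0l/Y0.
  exact: (step_mono (aY n) (aY n.+1) (sY n) (sY n.+1) (Yb n.+1) IH).
have [d [hd Yd]] := iteration_limit aY0 sY Y0 Yb (or_introl Ym).
exists d; split=> //.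
- exact: (ole_liml Yd Y0).
- exact: (ole_limr Yd Yb).
- move=> u hu u0 ub; apply: (ole_limr Yd).
  apply: (stay_le (Ig_rhs (lin_sol_adm hu)) hu) => //; last exact: Y0l.
  exact: aeW.
- move=> e /Yd[n0 H]; exists n0 => n nn x xL.
  by have [] := H n nn x xL.
Qed.

(** Dually, the iterates decrease from [beta] and stay above each solution; [stay_ge] needs them to
    lie below [beta] first, hence the order of the steps. *)
Lemma maximal_limit :
  (forall x, x \in `[0, L] ->
     Y 0%N 0%N x = beta 0%N x /\ Y 0%N 2%N x = beta 2%N x) ->
  exists d, [/\ lin_sol (rhs d) d, ole (@zero_d R) d, ole d beta,
    (forall u, lin_sol (rhs u) u -> ole (@zero_d R) u -> ole u beta -> ole u d) &
    unif_cvg_on L (fun n => Y n 0%N) (d 0%N)].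
Proof.
move=> Y0E.
have Y0l u : ole u beta -> ole u (Y 0%N).
  by move=> h x xL; have [-> ->] := Y0E x xL; exact: h.
have Y0g : ole (Y 0%N) beta.
  by move=> x xL; have [-> ->] := Y0E x xL.
have Yb := stay_le ihb hbeta beta_super (@ole_refl _) Y0g.
have Y0 := stay_ge (Ig_cst L 0) zero_sol zero_sub Yb (Y0l _ beta_ge0).
have Ym n : ole (Y n.+1) (Y n).
  elim: n => [|n IH]; first exact/Y0l/Yb.
  exact: (step_mono (aY n.+1) (aY n) (sY n.+1) (sY n) (Yb n) IH).
have [d [hd Yd]] := iteration_limit aY0 sY Y0 Yb (or_intror Ym).
exists d; split=> //.
- exact: (ole_liml Yd Y0).
- exact: (ole_limr Yd Yb).
- move=> u hu u0 ub; apply: (ole_liml Yd).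
  apply: (stay_ge (Ig_rhs (lin_sol_adm hu)) hu) => //; last exact: Y0l.
  exact: aeW.
- move=> e /Yd[n0 H]; exists n0 => n nn x xL.
  by have [] := H n nn x xL.
Qed.

End Sequences.

End MonotoneIteration.

(** * The upper solution and the original problem *)

Section Beta.
Variable R : realType.
Local Notation mu := (@lebesgue_measure R).
Variables (L lam : R).
Hypotheses (L0 : 0 < L) (lam0 : 0 < lam).
Local Notation beta := (beta_d L lam).
Local Notation w := (pi / L).

Let w_gt0 : 0 < w. Proof. by rewrite divr_gt0 // pi_gt0. Qed.

Lemma is_derive_beta k (x : R) : (k < 4)%N -> is_derive x 1 (beta k) (beta k.+1 x).
Proof.
rewrite /beta_d; move: (pi / L) => v.
by case: k => [|[|[|[|]]]] // _; apply: is_derive_eq; rewrite /GRing.scale /=; ring.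
Qed.

Lemma continuous_beta k : (k <= 4)%N -> continuous (beta k).
Proof.
rewrite leq_eqVlt => /predU1P[->|k4]; last first.
  by apply: continuous_is_derive => x; exact: is_derive_beta.
have c2 : continuous (beta 2%N).
  by apply: continuous_is_derive => x; exact: is_derive_beta.
(* The rule that [beta k.+1] is the derivative of [beta k] stops before k = 4, so the last entry is
   reduced to the second derivative. *)
have -> : beta 4%N = (fun x => - w ^+ 2 * beta 2%N x).
  by apply/funext => x; rewrite /beta_d; move: (pi / L) => v; ring.
by move=> x; apply: cvgM; [exact: cvg_cst|exact: c2].
Qed.

Lemma W41_beta : W41 L beta.
Proof.
have AC_beta k : (k < 4)%N -> AC L (beta k) (beta k.+1).
  move=> k4; apply: AC_smooth => //; last exact: continuous_beta.
  by move=> x; exact: is_derive_beta.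
split=> k k4; last by have [_ _] := AC_beta k k4.
case: k k4 => [|k] k4; first by have [] := AC_beta 0%N isT.
by have [] := AC_beta k k4.
Qed.

Lemma bc_beta : bc L beta.
Proof.
have wL : w * L = pi by rewrite divfK // gt_eqF.
by rewrite /bc /beta_d wL mulr0 sin0 sinpi !mulr0 oppr0.
Qed.

(** Since beta'' = - w^2 beta, the integral is read off from beta'(L) - beta'(0) = - 2 lam w. *)
Lemma int0_beta : int0 (beta 0%N) L = 2 * lam * (L / pi).
Proof.
have [hI hF] := W41_beta.
have LL : L \in `[0, L] by rewrite in_itv /= lexx ltW.
have := hF 1%N isT L LL.
have -> : int0 (beta 2%N) L = - w ^+ 2 * int0 (beta 0%N) L.
  rewrite -(int0Z _ (lexx L) (hI 0%N isT)); apply: int0_eq => t _.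
  by rewrite /beta_d; move: (pi / L) => v; ring.
have wL : w * L = pi by rewrite divfK // gt_eqF.
rewrite {1 2}/beta_d wL mulr0 cos0 cospi -[L / pi]invf_div.
move: w w_gt0 (int0 _ _) => v v0 I e.
have v_neq0 : v != 0 by rewrite gt_eqF.
have : v * (v * I - 2 * lam) = 0 by move: e; rewrite expr2; lra.
move/eqP; rewrite mulf_eq0 (negbTE v_neq0) /= subr_eq0 => /eqP <-.
by rewrite mulrC mulKf.
Qed.

Lemma sin_w_ge0 x : x \in `[0, L] -> 0 <= sin (w * x).
Proof.
rewrite in_itv /= => /andP[x0 xL]; apply: sin_ge0_pi.
rewrite mulr_ge0 ?(ltW w_gt0) //=.
have {2}-> : (pi : R) = w * L by rewrite divfK // gt_eqF.
by rewrite ler_wpM2l // ltW.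
Qed.

Lemma beta_ge0_le x : x \in `[0, L] -> 0 <= beta 0%N x /\ beta 2%N x <= 0.
Proof.
move=> xL; have h := sin_w_ge0 xL; rewrite /beta_d; split.
  by rewrite mulr_ge0 // ltW.
by rewrite oppr_le0 mulr_ge0 // mulr_ge0 ?ltW // exprn_gt0.
Qed.

Lemma beta2_lb x : - (lam * (pi ^+ 2 / L ^+ 2)) <= beta 2%N x.
Proof.
rewrite /beta_d lerN2 -expr_div_n -[leRHS]mulr1 ler_wpM2l ?sin_le1 //.
by rewrite mulr_ge0 // ltW // exprn_gt0.
Qed.

End Beta.

(** * Solutions of (P) as fixed points of the linear problem *)

Section Reformulation.
Variable R : realType.
Local Notation mu := (@lebesgue_measure R).
Variables (L a b c lam m : R) (p : R -> R).
Local Notation A := (2 * lam * (L / pi)).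
Local Notation B := (lam * (pi ^+ 2 / L ^+ 2)).
Local Notation N := (c + b * lam * pi ^+ 2 / L ^+ 2).
Hypothesis mE : m * m = a + 2 * b * lam * L / pi.
Local Notation rhs := (rhs L b A B p).
Local Notation lin_sol := (lin_sol L m N).

(** The terms that turn [a], [c] into M, N are added on both sides of the equation. *)
Lemma is_sol_lin d : is_sol L a b c p d <-> lin_sol (rhs d) d.
Proof.
have E x : (d 4%N x - m * m * d 2%N x + N * int0 (d 0%N) L = rhs d x) <->
    (opP L a b c d x = p x).
  rewrite mE /opP /rhs; move: (int0 _ _) (d 4%N x) (d 2%N x) (p x) => I u v q.
  move: pi (L) (L ^+ 2) => P K Q.
  have -> : u - (a + 2 * b * lam * K / P) * v + (c + b * lam * P ^+ 2 / Q) * I =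
    u - (a + b * I) * v + c * I +
    (b * v * I - b * (2 * lam * (K / P)) * v + b * (lam * (P ^+ 2 / Q)) * I) by ring.
  by split=> H; move: H; move: (K / P) (P ^+ 2 / Q) => ? ?; lra.
by split=> -[hW [hb e]]; split=> //; split=> //;
  apply: (ae_imp e) => t h tL; apply/E; exact: h.
Qed.

Lemma is_iteration_lin y0 Y : is_iteration L a b c lam p y0 Y <->
  (forall k x, x \in `[0, L] -> Y 0%N k x = y0 k x) /\
  forall n, lin_sol (rhs (Y n)) (Y n.+1).
Proof.
have E n x : rhs (Y n) x = p x + b * Y n 2%N x * int0 (Y n 0%N) L
           - 2 * b * lam * (L / pi) * Y n 2%N x
           + b * lam * (pi ^+ 2 / L ^+ 2) * int0 (Y n 0%N) L.
  rewrite /rhs; move: (int0 _ _) (L / pi) (pi ^+ 2 / L ^+ 2) => I u v; ring.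
split=> -[h0 h1]; split=> // n.
  have [hW [hb e]] := h1 n.+1 isT; split=> //; split=> //.
  by apply: (ae_imp e) => t h tL; rewrite mE (h tL) E.
case: n => // n _; have [hW [hb e]] := h1 n; split=> //; split=> //.
by apply: (ae_imp e) => t h tL; rewrite -E -(h tL) mE.
Qed.

Lemma inS_ole d : inS L lam d <->
  ole L (@zero_d R) d /\ ole L d (beta_d L lam).
Proof.
split=> [h|[h1 h2] x xL].
  by split=> x xL; have [/andP[? ?] /andP[? ?]] := h x xL.
by have [? ?] := h1 x xL; have [? ?] := h2 x xL; split; apply/andP.
Qed.

End Reformulation.

(** * Lower and upper solutions, and convergence to the extremal solutions *)

Unset Implicit Arguments.

Theorem theorem5p1 (R : realType) (L a b c lam : R) (p : R -> R) :
  0 < L -> 0 < a -> 0 < b -> 0 < c -> 0 < lam ->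
  (lebesgue_measure).-integrable `[0, L] (EFin \o p) ->
  {ae (@lebesgue_measure R), forall x, x \in `]0, L[ -> 0 <= p x} ->
  {ae (@lebesgue_measure R), forall x, x \in `]0, L[ ->
     p x <= (lam * pi ^+ 4 / L ^+ 4 + a * lam * pi ^+ 2 / L ^+ 2
             + 2 * b * lam ^+ 2 * pi / L) * sin (pi / L * x)
            + 2 * lam * c * L / pi} ->
  c + b * lam * pi ^+ 2 / L ^+ 2 <=
    4 * (a + 2 * b * lam * L / pi) / L ^+ 3
      * sigma (Num.sqrt (a + 2 * b * lam * L / pi) * L) ->
  is_lower_sol L a b c p (@zero_d R) /\
  is_upper_sol L a b c p (beta_d L lam) /\
  exists ymin ymax : nat -> R -> R,
    is_min_sol L a b c lam p ymin /\ is_max_sol L a b c lam p ymax /\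
    (exists Y, is_iteration L a b c lam p (@zero_d R) Y) /\
    (exists Y, is_iteration L a b c lam p (beta_d L lam) Y) /\
    (forall Y, is_iteration L a b c lam p (@zero_d R) Y ->
       unif_cvg_on L (fun n => Y n 0%N) (ymin 0%N)) /\
    (forall Y, is_iteration L a b c lam p (beta_d L lam) Y ->
       unif_cvg_on L (fun n => Y n 0%N) (ymax 0%N)).
Proof.
move=> L0 a0 b0 c0 lam0 ip p0 pub hsig.
have pi0 : 0 < pi :> R by exact: pi_gt0.
set M := a + 2 * b * lam * L / pi in hsig *.
set N := c + b * lam * pi ^+ 2 / L ^+ 2 in hsig *.
have M0 : 0 < M by rewrite addr_gt0 // divr_gt0 // !mulr_gt0.
have N0 : 0 < N by rewrite addr_gt0 // divr_gt0 ?exprn_gt0 // !mulr_gt0 ?exprn_gt0.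
pose m := Num.sqrt M.
have m0 : 0 < m by rewrite sqrtr_gt0.
have mE : m * m = M by rewrite -expr2 sqr_sqrtr // ltW.
have hkap : N * kap L m <= 1 + N * int0 (gg L m) L.
  by apply: sigma_kap => //; rewrite mE.
have hWb := W41_beta lam L0; have hbb := bc_beta lam L0.
have bI := int0_beta lam L0.
pose A := 2 * lam * (L / pi); pose B := lam * (pi ^+ 2 / L ^+ 2).
pose be := beta_d L lam.
have lower : is_lower_sol L a b c p (@zero_d R).
  have i0 : Ig L (fun=> 0 : R) by exact: Ig_cst.
  split.
    split=> [k _|k _ x /andP[x0 _]]; first exact: i0.
    by rewrite /zero_d int0_cst // mul0r addr0.
  have I0 : int0 (@zero_d R 0%N) L = 0.
    by have := int0_cst 0 (ltW L0); rewrite mul0r.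
  split=> //; apply: (ae_imp p0) => t /[apply].
  by rewrite /opP I0 /zero_d !mulr0 subr0 addr0.
(* At [be] the operator equals the assumed majorant of p, so being an upper solution is exactly that
   hypothesis. *)
have opb x : opP L a b c be x =
   (lam * pi ^+ 4 / L ^+ 4 + a * lam * pi ^+ 2 / L ^+ 2
             + 2 * b * lam ^+ 2 * pi / L) * sin (pi / L * x)
            + 2 * lam * c * L / pi.
  rewrite /opP bI /be /beta_d; move: (sin _) => s.
  by move: pi pi0 => P P0; field; rewrite !gt_eqF.
have upper : is_upper_sol L a b c p be.
  by split=> //; split=> //; apply: (ae_imp pub) => t /[apply]; rewrite opb.
(* [hb] is the source for which [be] solves the linear problem; the upper solution inequality
   becomes rhs be <= hb. *)
pose hb x := be 4%N x - m * m * be 2%N x + N * int0 (be 0%N) L.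
have ihb : Ig L hb.
  have [iW _] := hWb; apply: IgD; last exact: Ig_cst.
  by apply: IgB; [exact: iW|apply: IgZ; exact: iW].
have hbeta : lin_sol L m N hb be by split=> //; split=> //; exact: aeW.
have blb x : x \in `[0, L] -> - B <= be 2%N x by move=> _; exact: beta2_lb.
have b_ge0 : ole L (@zero_d R) be by move=> x xL; exact: beta_ge0_le.
have bsup : {ae (@lebesgue_measure R), forall x, x \in `]0, L[ ->
    rhs L b A B p be x <= hb x}.
  apply: (ae_imp pub) => t /[apply]; rewrite -opb /opP /hb /rhs mE bI -/A.
  rewrite /M /N; move: (be 4%N t) (be 2%N t) (p t) => u v q H.
  have -> : q + b * v * A - b * A * v + b * B * A = q + b * B * A by ring.
  rewrite -subr_ge0; move: H; rewrite -subr_ge0; congr (_ <= _).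
  by rewrite /A /B; move: pi (L) (L ^+ 2) => P K Q; ring.
have a_zero : adm L (@zero_d R) by split; exact: Ig_cst.
have a_be : adm L be by exact: lin_sol_adm hbeta.
have solE := is_sol_lin c p mE.
have itE := is_iteration_lin c p mE.
have hmin Y : is_iteration L a b c lam p (@zero_d R) Y ->
  exists d, is_min_sol L a b c lam p d /\ unif_cvg_on L (fun n => Y n 0%N) (d 0%N).
  move=> /itE[Y0E sY].
  have aY0 : adm L (Y 0%N).
    by split; apply: Ig_eq (Ig_cst L 0) => t tL; rewrite Y0E.
  have [d [d1 d2 d3 d4 d5]] := minimal_limit L0 m0 N0 b0 hkap ip bI blb ihb hbeta
    p0 bsup b_ge0 aY0 sY (fun x xL => conj (Y0E 0%N x xL) (Y0E 2%N x xL)).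
  exists d; split=> //; split; first exact/solE.
  split; first exact/inS_ole.
  by move=> u /solE hu /inS_ole[u0 ub] x xL; have [] := d4 u hu u0 ub x xL.
have hmax Y : is_iteration L a b c lam p be Y ->
  exists d, is_max_sol L a b c lam p d /\ unif_cvg_on L (fun n => Y n 0%N) (d 0%N).
  move=> /itE[Y0E sY].
  have aY0 : adm L (Y 0%N).
    have [i1 i2] := a_be.
    by split; [apply: Ig_eq i1|apply: Ig_eq i2] => t tL; rewrite Y0E.
  have [d [d1 d2 d3 d4 d5]] := maximal_limit L0 m0 N0 b0 hkap ip bI blb ihb hbeta
    p0 bsup b_ge0 aY0 sY (fun x xL => conj (Y0E 0%N x xL) (Y0E 2%N x xL)).
  exists d; split=> //; split; first exact/solE.
  split; first exact/inS_ole.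
  by move=> u /solE hu /inS_ole[u0 ub] x xL; have [] := d4 u hu u0 ub x xL.
(* [hmin] and [hmax] extract extremal solutions from given iterations, so one iteration of each kind
   is constructed first. *)
have [Y [Y0 sY]] := exists_iteration b A B L0 m0 N0 ip a_zero.
have [Z [Z0 sZ]] := exists_iteration b A B L0 m0 N0 ip a_be.
have iY : is_iteration L a b c lam p (@zero_d R) Y.
  by apply/itE; split=> // k x _; rewrite Y0.
have iZ : is_iteration L a b c lam p be Z.
  by apply/itE; split=> // k x _; rewrite Z0.
have [ymin [min1 _]] := hmin Y iY.
have [ymax [max1 _]] := hmax Z iZ.
split=> //; split=> //; exists ymin, ymax; split=> //; split=> //.
split; first by exists Y.
split; first by exists Z.
split=> X iX.
(* The limit [d] of an arbitrary iteration is also a minimal solution, and two minimal solutions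
   agree on [0, L] by mutual comparison. *)
- have [d [dmin dcvg]] := hmin X iX => e /dcvg[n0 H]; exists n0 => n nn x xL.
  have [s1 [t1 u1]] := min1; have [s2 [t2 u2]] := dmin.
  have -> : ymin 0%N x = d 0%N x by apply/eqP; rewrite eq_le u1 // u2.
  exact: H.
- have [d [dmax dcvg]] := hmax X iX => e /dcvg[n0 H]; exists n0 => n nn x xL.
  have [s1 [t1 u1]] := max1; have [s2 [t2 u2]] := dmax.
  have -> : ymax 0%N x = d 0%N x by apply/eqP; rewrite eq_le u1 // u2.
  exact: H.
Qed.
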